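(* Let $N=\binom n2$ (so that there are $2N$ ordered pairs of distinct vertices of $[n]$). For each $n$ let $\mathscr S=\mathscr S(n)$ be a set of labelled directed graphs on the vertex set $[n]$, each having exactly $h=h(n)$ directed edges, and let $X_n$ be the number of members of $\mathscr S$ contained in the random digraph under consideration. (1) Let $m=m(n)$ be an integer sequence and $\mu_n=|\mathscr S|\binom{2N-h}{m-h}\big/\binom{2N}{m}$. Assume that $h^3=o(m^2)$, $h^2=\Omega(m)$, and that for $\rho(n)=h^2/m$ and some function $\gamma(n)$: (a) for all $K>0$ and all $1\le j\le K\rho(n)$, $r_j=\frac{h^2}{2Nj}(1+o(m/h^2))$; (b) $r_j\le m/(4N)$ for all $4\rho(n)\le j\le\gamma(n)$; (c) $\sum_{j>\gamma(n)}f_j=o(\mu_n|\mathscr S|)$. Then in $\mathcal D(n,m)$, $X_n/\mathbf E_{\mathcal D(n,m)}(X_n)\xrightarrow{p}1$ as $n\to\infty$. (2) Let $p=p(n)\in(0,1)$ and assume $h^3=o(p^2n^4)$. Let $\beta_n=h\sqrt{(1-p)/(2pN)}$ and $\lambda_n=|\mathscr S|p^h$, and assume $\liminf_{n\to\infty}\beta_n>0$. If for all $m=2pN+O(\sqrt{2pN})$ we have $X_n/\mathbf E_{\mathcal D(n,m)}(X_n)\xrightarrow{p}1$ in $\mathcal D(n,m)$, then in $\mathcal D(n,p)$, $$\frac{\ln\bigl(e^{\beta_n^2/2}X_n/\lambda_n\bigr)}{\beta_n}\xrightarrow{d}\mathcal N(0,1)\quad\text{as } n\to\infty.$$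
   Context: $\mathcal D(n,m)$ is the random digraph on vertex set $[n]$ whose $m$ directed edges are chosen uniformly at random from the $2N$ ordered pairs of distinct vertices; $\mathcal D(n,p)$ is the random digraph on $[n]$ including each possible directed edge independently with probability $p$. All asymptotics are as $n\to\infty$; error terms involving $j$ are uniform over the stated range of $j$ (for each fixed $K$). For $j\ge0$, $f_j$ is the number of ordered pairs $(H_1,H_2)\in\mathscr S\times\mathscr S$ having exactly $j$ directed edges in common, and $r_j=f_j/f_{j-1}$ for $j\ge1$ whenever $f_{j-1}\neq0$. ''For all $m=2pN+O(\sqrt{2pN})$'' means for every integer sequence $m(n)$ with $|m-2pN|=O(\sqrt{2pN})$. $\mathcal N(0,1)$ is the standard normal distribution; $\xrightarrow{p}$, $\xrightarrow{d}$ denote convergence in probability and in distribution. *)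

(* Defs.v *)
From HB Require Import structures.
From mathcomp Require Import all_boot all_order all_algebra.
From mathcomp Require Import all_classical all_reals all_analysis.
Import Order.TTheory GRing.Theory Num.Theory.
Import numFieldNormedType.Exports.

Set Implicit Arguments.
Unset Strict Implicit.
Unset Printing Implicit Defensive.

Local Open Scope classical_set_scope.
Local Open Scope ring_scope.

Definition arc (n : nat) := {e : 'I_n * 'I_n | e.1 != e.2}.

(* A labelled digraph on [n] is identified with its set of arcs. *)
Definition digraph (n : nat) := {set arc n}.

(* nbpairs n is N, so that there are 2N possible arcs (card_arc below). *)
Definition nbpairs (n : nat) : nat := 'C(n, 2).

Definition nbcopies (n : nat) (S : {set digraph n}) (G : digraph n) : nat :=
  #|[set H in S | H \subset G]%SET|.

Definition nbshare (n : nat) (S : {set digraph n}) (j : nat) : nat :=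
  #|[set H : digraph n * digraph n |
      [&& H.1 \in S, H.2 \in S & #|H.1 :&: H.2| == j]]%SET|.

(* Meaningful for 0 < j and nbshare S j.-1 != 0 only; it has the junk value 0
   when nbshare S j.-1 = 0. *)
Definition share_ratio (R : realType) (n : nat) (S : {set digraph n}) (j : nat) : R :=
  (nbshare S j)%:R / (nbshare S j.-1)%:R.

(* The subtractions are truncated, so this is the intended number only when
   h <= m and h <= 2N. *)
Definition mean_formula (R : realType) (n : nat) (S : {set digraph n})
    (h m : nat) : R :=
  #|S|%:R * 'C(2 * nbpairs n - h, m - h)%:R / 'C(2 * nbpairs n, m)%:R.

(* Finite probability spaces are given by their mass function mu. *)
Definition Pr (R : realType) (T : finType) (mu : T -> R) (A : pred T) : R :=
  \sum_(w | A w) mu w.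

Definition Ex (R : realType) (T : finType) (mu : T -> R) (Y : T -> R) : R :=
  \sum_w mu w * Y w.

(* It is a probability only when m <= 2N. *)
Definition Dnm (R : realType) (n m : nat) (G : digraph n) : R :=
  if #|G| == m then #|[set H : digraph n | #|H| == m]%SET|%:R^-1 else 0.

Definition Dnp (R : realType) (n : nat) (p : R) (G : digraph n) : R :=
  \prod_(e : arc n) (if e \in G then p else 1 - p).

(* Convergence in probability to a constant; the random variables may live on
   different spaces. *)
Definition cvg_in_prob (R : realType) (T : nat -> finType)
    (mu : forall n, T n -> R) (Y : forall n, T n -> R) (l : R) : Prop :=
  forall eps : R, 0 < eps ->
    Pr (@mu n) (fun w => eps < `|Y n w - l|) @[n --> \oo] --> (0 : R).

(* Convergence in distribution to a probability Q on the real line. Extended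
   real values are allowed, so that the logarithm of a count that may vanish
   is covered, with the value -oo. *)
Definition cvg_in_distr (R : realType) (T : nat -> finType)
    (mu : forall n, T n -> R) (Y : forall n, T n -> \bar R)
    (Q : probability (measurableTypeR R) R) : Prop :=
  forall x : R, {for x, continuous (fun t : R => Q `]-oo, t]%classic)} ->
    (Pr (@mu n) (fun w => Y n w <= x%:E)%E)%:E @[n --> \oo] --> Q `]-oo, x]%classic.

Lemma card_arc (n : nat) : #|{: arc n}| = (2 * nbpairs n)%N.
Proof.
rewrite card_sig (eq_card (B := predC (fun e : 'I_n * 'I_n => e.1 == e.2)))//.
have := cardC (fun e : 'I_n * 'I_n => e.1 == e.2).
rewrite card_prod card_ord.
have -> : #|(fun e : 'I_n * 'I_n => e.1 == e.2)| = n.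
  transitivity #|[set (i, i) | i : 'I_n]|%SET.
    apply: eq_card => -[i j]; rewrite !unfold_in /=.
    apply/eqP/imsetP => [->|[k _ [-> ->]]//]; by exists j.
  by rewrite card_imset ?card_ord// => i j [].
move=> /(congr1 (subn^~ n)); rewrite addKn => ->.
rewrite /nbpairs bin2 mul2n.
have -> : (n * n - n = n * n.-1)%N by case: n => // n; rewrite mulnS addKn.
apply/esym; rewrite -[RHS]odd_double_half; case: n => // n.
by rewrite oddM /= andNb.
Qed.

Lemma Dnm_total (R : realType) (n m : nat) : (m <= 2 * nbpairs n)%N ->
  Pr (@Dnm R n m) xpredT = 1.
Proof.
move=> mN; rewrite /Pr /Dnm -big_mkcond.
rewrite (eq_bigl [in [set H : digraph n | #|H| == m]%SET]) => [|H]; last first.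
  by rewrite inE.
rewrite big_const iter_addr_0 -[LHS]mulr_natl divff// pnatr_eq0.
by rewrite card_draws card_arc -lt0n bin_gt0.
Qed.

Lemma Dnp_total (R : realType) (n : nat) (p : R) : Pr (@Dnp R n p) xpredT = 1.
Proof.
rewrite /Pr /Dnp -(bigA_distr _ _ (fun=> p) (fun=> 1 - p)).
by rewrite big1// => e _; rewrite /= addrC subrK.
Qed.

(* Main.v *)
Require Import Defs.
From mathcomp Require Import all_boot all_order all_algebra.
From mathcomp Require Import all_classical all_reals all_analysis.
From mathcomp Require Import measurable_realfun ring lra zify.
Import Order.TTheory GRing.Theory Num.Theory.
Import numFieldNormedType.Exports.
Local Open Scope classical_set_scope.
Local Open Scope ring_scope.

(** Both parts are about the number [X] of members of [S] in a random digraph on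
    [n] vertices, which has [a = 2 N] possible arcs.

    For the uniform digraph with [m] arcs this is a second moment argument. The
    probability that [k] given arcs are present is a quotient of falling
    factorials, [incl_prob], so [E X] and [E X ^ 2] are explicit in [|S|] and in
    the overlap counts [f_j]. By (a) these counts look like a Poisson law of mean
    [h ^ 2 / a]; the inclusion probability grows by a factor about [a / m] with
    each common arc, which turns them into a Poisson law of mean
    [rho = h ^ 2 / m]. The factor [exp (rho - h ^ 2 / a)] by which this increases
    the total is lost again in [incl_prob_double]. All corrections to the exponent
    are small since [h ^ 3 = o (m ^ 2)]; beyond [K rho] hypothesis (b) makes the
    terms decay geometrically, and (c) handles the rest; this is
    [second_moment_le]. Hence [E X ^ 2 / (E X) ^ 2] tends to [1], and
    Chebyshev's inequality concludes.

    For independent arcs, condition on the number [M] of arcs: given [M = m] the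
    digraph is uniform ([Pr_Dnp]), so the first kind of concentration says that
    [X] is close to its mean [E_m X] with high probability, uniformly for [m] in a
    window of width [O (s)] around the mean [T = 2 p N], where
    [s ^ 2 = T (1 - p)] ([rel_dev_uniform]). With [x = (m - T) / s], a second-order
    expansion of the falling factorials gives
    [ln (E_m X / lambda) = beta x - beta ^ 2 / 2 + o (1)] ([ln_incl_prob]). So the
    statistic is [x + o (1)], and [x] is asymptotically normal by the theorem of
    de Moivre and Laplace ([de_moivre_laplace]).

    The latter is proved for triangular arrays without Stirling's formula: on a
    window of bounded [x] the ratios of consecutive binomial masses agree with
    those of the normal density up to [1 + O (1 / s ^ 2)], hence the masses are
    proportional to the normal masses of the corresponding cells up to
    [1 + O (1 / s)], and Chebyshev's inequality shows that a large window carries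
    almost all of both laws. *)

Set Implicit Arguments.
Unset Strict Implicit.

(** * Inclusion probabilities *)

Lemma card_supersets (T : finType) (H : {set T}) (k : nat) : (#|H| <= k)%N ->
  #|[set G : {set T} | (#|G| == k) && (H \subset G)]%SET|
  = 'C(#|T| - #|H|, k - #|H|).
Proof.
move=> Hk; have -> : (#|T| - #|H|)%N = #|(~: H)%SET| by rewrite -(cardsC H) addKn.
rewrite -cards_draws.
rewrite -[LHS](card_in_imset (f := fun G => (H :|: ~: G)%SET)) => [|G G']; last first.
  rewrite !inE => /andP[_ /fintype.subsetP HG] /andP[_ /fintype.subsetP HG'] /setP E.
  apply/setP => x; have := E x; rewrite !inE.
  by have [/[dup] /HG -> /HG' ->|_ /negb_inj] := boolP (x \in H).
rewrite -[RHS](card_imset _ (@finset.setC_inj T)).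
apply: eq_card => B; apply/imsetP/imsetP => -[G]; rewrite inE => /andP[].
  move=> /eqP Gk HG ->; exists (G :\: H)%SET.
    by rewrite inE finset.setDE finset.subsetIr -finset.setDE cardsD (finset.setIidPr HG) Gk eqxx.
  by rewrite finset.setDE finset.setCI finset.setCK finset.setUC.
move=> GH /eqP Gk ->; exists (H :|: G)%SET.
  rewrite inE finset.subsetUl andbT cardsU.
  have -> : (H :&: G)%SET = finset.set0.
    by apply/eqP; rewrite finset.setIC setI_eq0 finset.disjoints_subset.
  by rewrite cards0 subn0 Gk subnKC.
by rewrite finset.setCU finset.setUIr finset.setUCr finset.setTI (finset.setUidPr _)// -finset.setCS finset.setCK.
Qed.

(** The probability that a uniform random [m]-subset of an [a]-set contains a
    given [k]-subset. Falling factorials make the formula valid for [k > m]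
    too, where it vanishes. *)
Definition incl_prob (R : realType) (a m k : nat) : R :=
  (m ^_ k)%:R / (a ^_ k)%:R.

Section InclProb.
Variable R : realType.
Implicit Types a m k : nat.
Local Notation Q := (@incl_prob R).

Lemma incl_prob_ge0 a m k : 0 <= Q a m k.
Proof. by rewrite divr_ge0. Qed.

Lemma incl_prob_gt0 a m k : (k <= m)%N -> (m <= a)%N -> 0 < Q a m k.
Proof.
by move=> km ma; rewrite divr_gt0 ?ltr0n ?ffact_gt0// (leq_trans km).
Qed.

Lemma incl_probS a m k : Q a m k.+1 = Q a m k * ((m - k)%:R / (a - k)%:R).
Proof. by rewrite /incl_prob !ffactnSr !natrM invfM mulrACA. Qed.

Lemma incl_prob_bin a m k : (k <= m)%N -> (m <= a)%N ->
  'C(a - k, m - k)%:R / 'C(a, m)%:R = Q a m k.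
Proof.
move=> km ma; have ka := leq_trans km ma.
apply/eqP; rewrite eqr_div ?pnatr_eq0 -?lt0n ?bin_gt0 ?ffact_gt0// -!natrM eqr_nat.
have fp j : (0 < j`!)%N := fact_gt0 j.
rewrite -(eqn_pmul2r (fp (m - k)%N)) -(eqn_pmul2r (fp (a - m)%N)).
have E1 : ('C(a - k, m - k) * ((m - k)`! * (a - m)`!) = (a - k)`!)%N.
  by rewrite -(bin_fact (leq_sub2r k ma)) -subnDA subnKC.
have E2 := bin_fact ma; have E3 := ffact_fact km; have E4 := ffact_fact ka.
apply/eqP; transitivity a`!; first by rewrite -E4 -E1; ring.
by rewrite -E2 -E3; ring.
Qed.

End InclProb.

(** * Finite probability spaces and the moments of the number of copies *)

Section FiniteProb.
Variables (R : realType) (T : finType) (mu : T -> R).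
Implicit Types (A B : pred T) (Y Z : T -> R).

Lemma Pr_Ex A : Pr mu A = Ex mu (fun w => (A w)%:R).
Proof.
rewrite /Pr big_mkcond; apply: eq_bigr => w _.
by case: (A w); rewrite (mulr1, mulr0).
Qed.

Lemma Ex_sum (I : finType) (P : pred I) (F : I -> T -> R) :
  Ex mu (fun w => \sum_(i | P i) F i w) = \sum_(i | P i) Ex mu (F i).
Proof.
by rewrite /Ex exchange_big; apply: eq_bigr => w _; rewrite mulr_sumr.
Qed.

Hypothesis mu_ge0 : forall w, 0 <= mu w.

Lemma Pr_ge0 A : 0 <= Pr mu A.
Proof. by apply: sumr_ge0. Qed.

Lemma le_Pr A B : (forall w, A w -> B w) -> Pr mu A <= Pr mu B.
Proof.
move=> AB; rewrite /Pr [leLHS]big_mkcond [leRHS]big_mkcond.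
apply: ler_sum => w _; case: ifPn => [/AB ->//|_].
by case: ifP.
Qed.

Lemma Pr_union A B : Pr mu (fun w => A w || B w) <= Pr mu A + Pr mu B.
Proof.
rewrite /Pr big_mkcond [X in _ <= X + _]big_mkcond [X in _ <= _ + X]big_mkcond.
rewrite -big_split; apply: ler_sum => w _ /=.
by case: (A w); case: (B w); rewrite ?addr0 ?add0r ?lerDl.
Qed.

Lemma Pr_chebyshev Y (c eps : R) : 0 < eps ->
  Pr mu (fun w => eps < `|Y w - c|) <= Ex mu (fun w => (Y w - c) ^+ 2) / eps ^+ 2.
Proof.
move=> e0; rewrite ler_pdivlMr ?exprn_gt0// Pr_Ex /Ex mulr_suml.
apply: ler_sum => w _; rewrite -mulrA ler_wpM2l//.
case: ltP => [lt|_]; rewrite ?mul0r ?sqr_ge0// mul1r -(real_normK (num_real (Y w - c))).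
by rewrite ler_sqr ?nnegrE// ltW.
Qed.

End FiniteProb.

Section Dnm.
Variables (R : realType) (n m : nat).
Local Notation a := (2 * nbpairs n)%N.
Hypothesis m_le : (m <= a)%N.
Implicit Types (H G : digraph n) (S : {set digraph n}).

Lemma Dnm_ge0 G : 0 <= Dnm R m G.
Proof. by rewrite /Dnm; case: ifP. Qed.

Lemma Pr_Dnm_subset H :
  Pr (@Dnm R n m) (fun G => H \subset G) = incl_prob R a m #|H|.
Proof.
have cardm : #|[set G : digraph n | #|G| == m]%SET| = 'C(a, m).
  by rewrite card_draws card_arc.
rewrite /Pr /Dnm -big_mkcondr /= cardm.
rewrite (eq_bigl [in [set G : digraph n | (#|G| == m) && (H \subset G)]%SET]); last first.
  by move=> G; rewrite inE andbC.
rewrite big_const iter_addr_0 -[LHS]mulr_natl.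
have [Hm|mH] := leqP #|H| m.
  by rewrite card_supersets// card_arc incl_prob_bin.
rewrite /incl_prob ffact_small// mul0r.
rewrite (_ : #|_| = 0%N) ?mul0r//; apply: eq_card0 => G.
rewrite !inE; apply/negbTE/negP => /andP[/eqP Gm /subset_leq_card].
by rewrite Gm leqNgt mH.
Qed.

Lemma nbcopiesE S G :
  (nbcopies S G)%:R = \sum_(H in S) ((H \subset G)%:R : R).
Proof.
rewrite /nbcopies -sum1_card natr_sum (eq_bigl (fun H => (H \in S) && (H \subset G))).
  by rewrite big_mkcondr; apply: eq_bigr => H _; case: (H \subset G).
by move=> H; rewrite inE.
Qed.

Variables (h : nat) (S : {set digraph n}).
Hypothesis hS : forall H, H \in S -> #|H| = h.

Lemma Ex_nbcopies :
  Ex (@Dnm R n m) (fun G => (nbcopies S G)%:R) = #|S|%:R * incl_prob R a m h.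
Proof.
under [X in Ex _ X]eq_fun do rewrite nbcopiesE.
rewrite Ex_sum (eq_bigr (fun=> incl_prob R a m h)) => [|H HS].
  by rewrite big_const iter_addr_0 mulr_natl.
by rewrite -Pr_Ex Pr_Dnm_subset hS.
Qed.

(** The union of two copies with [j] common arcs has [2 h - j] arcs. *)
Lemma Ex_nbcopies_sqr :
  Ex (@Dnm R n m) (fun G => (nbcopies S G)%:R ^+ 2) =
  \sum_(j < h.+1) (nbshare S j)%:R * incl_prob R a m (2 * h - j).
Proof.
under [X in Ex _ X]eq_fun => G.
  rewrite nbcopiesE expr2 big_distrlr /= pair_big /=.
  under eq_bigr => H _ do rewrite -natrM mulnb -finset.subUset.
  over.
rewrite Ex_sum.
rewrite (partition_big (fun H : digraph n * digraph n => inord #|H.1 :&: H.2|%SET : 'I_h.+1) xpredT) //=.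
apply: eq_bigr => j _.
rewrite (eq_bigl [in [set H : digraph n * digraph n |
      [&& H.1 \in S, H.2 \in S & #|H.1 :&: H.2|%SET == j]]%SET]); last first.
  move=> [H1 H2]; rewrite !inE /= -andbA; apply: andb_id2l => H1S.
  apply: andb_id2l => H2S; rewrite -val_eqE /= inordK// ltnS -(hS H1S).
  by apply/subset_leq_card/finset.subsetIl.
rewrite (eq_bigr (fun=> incl_prob R a m (2 * h - j))) => [|[H1 H2]].
  by rewrite big_const iter_addr_0 mulr_natl.
rewrite inE => /and3P[/= H1S H2S /eqP H12].
rewrite -Pr_Ex Pr_Dnm_subset cardsU H12 (hS H1S) (hS H2S).
by rewrite addnn -mul2n.
Qed.

Lemma sum_nbshare_le k : (\sum_(j < k) nbshare S j <= #|S| ^ 2)%N.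
Proof.
rewrite -mulnn -cardsX.
under eq_bigr do rewrite /nbshare -sum1_card.
rewrite -sum1_card (exchange_big_dep [in finset.setX S S]) /=; last first.
  by move=> j H _; rewrite !inE => /and3P[-> ->].
apply: leq_sum => H; rewrite inE => /andP[H1S H2S].
have [lt|ge] := ltnP #|H.1 :&: H.2|%SET k; last first.
  rewrite big1// => j; rewrite inE => /and3P[_ _ /eqP E].
  by have := ltn_ord j; rewrite -E ltnNge ge.
rewrite (big_pred1 (Ordinal lt))// => j.
by rewrite inE H1S H2S; apply: eq_sym.
Qed.

Lemma mean_formulaE : (h <= m)%N ->
  mean_formula R S h m = #|S|%:R * incl_prob R a m h.
Proof. by move=> hm; rewrite /mean_formula -mulrA incl_prob_bin. Qed.

(** Chebyshev's inequality at the mean: the variance of [X / E X] is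
    [E X ^ 2 / (E X) ^ 2 - 1]. *)
Lemma Pr_nbcopies_dev (eps eta : R) : 0 < eps -> S != finset.set0 -> (h <= m)%N ->
  Ex (@Dnm R n m) (fun G => (nbcopies S G)%:R ^+ 2)
    <= (1 + eta) * Ex (@Dnm R n m) (fun G => (nbcopies S G)%:R) ^+ 2 ->
  Pr (@Dnm R n m) (fun G => eps < `|(nbcopies S G)%:R
     / Ex (@Dnm R n m) (fun G' => (nbcopies S G')%:R) - 1|) <= eta / eps ^+ 2.
Proof.
move=> e0 S0 hm; set mu := @Dnm R n m; set E := Ex mu (fun G => (nbcopies S G)%:R) => le2.
have E0 : 0 < E.
  by rewrite /E /mu Ex_nbcopies mulr_gt0 ?incl_prob_gt0// ltr0n card_gt0.
apply: le_trans (Pr_chebyshev _ _ _ e0) _; first exact: Dnm_ge0.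
rewrite ler_pM2r ?invr_gt0 ?exprn_gt0//.
have lin c : c != 0 -> Ex mu (fun G => ((nbcopies S G)%:R / c - 1) ^+ 2) =
   Ex mu (fun G => (nbcopies S G)%:R ^+ 2) / c ^+ 2 - 2 * (E / c) + Pr mu xpredT.
  move=> c0; rewrite /E /Ex /Pr !mulr_suml mulr_sumr -sumrB -big_split /=.
  by apply: eq_bigr => G _; field.
rewrite lin ?lt0r_neq0// Dnm_total// divff ?lt0r_neq0//.
suff : Ex mu (fun G => (nbcopies S G)%:R ^+ 2) / E ^+ 2 <= 1 + eta by lra.
by rewrite ler_pdivrMr ?exprn_gt0.
Qed.

End Dnm.

(** * Partial sums of the exponential series; bounds on inclusion probabilities *)

Section ExpPartialSums.
Variable R : realType.
Implicit Types (x y : R) (n : nat).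

(** Up to the factor [exp (- x)], the probability that a Poisson variable of mean
    [x] is less than [n]. *)
Definition exp_psum n x : R := \sum_(j < n) x ^+ j / j`!%:R.

Lemma exp_psumE n x : exp_psum n x = series (exp_coeff x) n.
Proof. by rewrite /exp_psum /series /= big_mkord. Qed.

Lemma exp_psum_le n x : 0 <= x -> exp_psum n x <= expR x.
Proof.
move=> x0; rewrite exp_psumE; apply: nondecreasing_cvgn_le.
  apply: nondecreasing_series => i _ _; exact: exp_coeff_ge0.
exact: is_cvg_series_exp_coeff.
Qed.

Lemma expR1_le4 : expR 1 <= 4 :> R.
Proof.
have : 2^-1 <= expR (- 2^-1) :> R by apply: le_trans (expR_ge1Dx _); lra.
rewrite expRN lef_pV2 ?posrE ?expR_gt0// => le2.
have -> : (1 : R) = 2^-1 + 2^-1 by lra.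
have := expR_ge0 (2^-1 : R).
by rewrite expRD => ge0; apply: (@le_trans _ _ (2 * 2)); [apply: ler_pM|lra].
Qed.

(** The term of index [n] of the series at [e x] is [exp n] times the one at [x],
    and [e <= 4]. The bound is negligible against [exp x] once [n] is a large
    multiple of [x]. *)
Lemma exp_term_le n x : 0 <= x -> x ^+ n / n`!%:R <= expR (4 * x - n%:R).
Proof.
move=> x0; have y0 : 0 <= expR 1 * x by rewrite mulr_ge0 ?expR_ge0.
rewrite expRB ler_pdivlMr ?expR_gt0//.
have -> : expR (n%:R : R) = expR 1 ^+ n by rewrite -expRM_natl mulr1.
rewrite mulrAC -exprMn [x * _]mulrC.
apply: (@le_trans _ _ (expR (expR 1 * x))); last first.
  by rewrite ler_expR ler_wpM2r// expR1_le4.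
apply: le_trans (exp_psum_le n.+1 y0).
rewrite /exp_psum big_ord_recr /= lerDr sumr_ge0// => i _.
by rewrite divr_ge0// exprn_ge0.
Qed.

(** The same comparison with the series at [e x], for the whole tail. *)
Lemma exp_psum_ge n x : 0 <= x ->
  expR x - expR (4 * x - n%:R) <= exp_psum n.+1 x.
Proof.
move=> x0; have y0 : 0 <= expR 1 * x by rewrite mulr_ge0 ?expR_ge0.
have eN : expR (n%:R : R) = expR 1 ^+ n by rewrite -expRM_natl mulr1.
have e1 : 1 <= expR 1 :> R by apply: le_trans (expR_ge1Dx _); lra.
suff : expR x <= exp_psum n.+1 x + expR (4 * x - n%:R) by lra.
apply: limr_le; first exact: is_cvg_series_exp_coeff.
near=> N; rewrite -exp_psumE.
apply: (@le_trans _ _ (exp_psum n.+1 x + exp_psum N (expR 1 * x) / expR n%:R)).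
  have [Nn|nN] := leqP N n.+1.
    rewrite -[leLHS]addr0 lerD//.
      rewrite /exp_psum (big_ord_widen_cond _ xpredT (fun j => x ^+ j / j`!%:R) Nn) big_mkcond.
      apply: ler_sum => i _; case: ifP => // _.
      by rewrite divr_ge0// exprn_ge0.
    by rewrite divr_ge0 ?expR_ge0// sumr_ge0// => i _; rewrite divr_ge0// exprn_ge0.
  rewrite {1 2}/exp_psum (big_ord_widen_cond _ xpredT (fun j => x ^+ j / j`!%:R) (ltnW nN)) [X in _ <= X + _]big_mkcond.
  rewrite /exp_psum mulr_suml -big_split /=; apply: ler_sum => i _.
  have t0 : 0 <= x ^+ i / i`!%:R by rewrite divr_ge0// exprn_ge0.
  have s0 : 0 <= (expR 1 * x) ^+ i / i`!%:R / expR n%:R.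
    by rewrite !divr_ge0 ?expR_ge0// exprn_ge0.
  case: ifPn => [_|]; first by rewrite lerDl.
  rewrite -leqNgt add0r ler_pdivlMr ?expR_gt0// eN exprMn -[leRHS]mulrA [leLHS]mulrC => ni.
  by rewrite ler_wpM2r// ler_weXn2l// ltnW.
rewrite lerD2l expRB ler_wpM2r ?invr_ge0 ?expR_ge0//.
apply: le_trans (exp_psum_le _ y0) _.
by rewrite ler_expR ler_wpM2r// expR1_le4.
Unshelve. all: by end_near. Qed.

End ExpPartialSums.

Section InclProbBounds.
Variables (R : realType) (a m h : nat).
Hypotheses (h2m : (2 * h < m)%N) (ma : (m <= a)%N).
Local Notation Q := (@incl_prob R a m).

Lemma incl_prob_antitone k l : (k <= l)%N -> Q l <= Q k.
Proof.
move=> /subnKC <-; elim: (l - k)%N => [|i IH]; first by rewrite addn0.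
rewrite addnS incl_probS; apply: le_trans IH.
rewrite ler_piMr ?incl_prob_ge0//.
have [E|] := eqVneq (a - (k + i))%N 0%N; first by rewrite E invr0 mulr0.
rewrite -lt0n => a0; rewrite ler_pdivrMr ?ltr0n// mul1r ler_nat.
by rewrite leq_sub2r.
Qed.

Let t : R := a%:R / (m%:R - 2 * h%:R).

(** Each arc fewer to be included gains a factor [a / (m - 2 h)] at most, which
    is close to [a / m] when [h] is small against [m]. *)
Lemma incl_prob_pred j : Q (2 * h - j.+1) <= Q (2 * h - j) * t.
Proof.
have hmR : 2 * h%:R < m%:R :> R by rewrite -natrM ltr_nat.
have maR : m%:R <= a%:R :> R by rewrite ler_nat.
have h0 := ler0n R h.
have t1 : 1 <= t by rewrite ler_pdivlMr ?subr_gt0// mul1r; lra.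
have [lt|ge] := ltnP j (2 * h)%N; last first.
  have -> : (2 * h - j.+1 = 2 * h - j)%N by lia.
  by rewrite ler_peMr ?incl_prob_ge0.
have -> : (2 * h - j = (2 * h - j.+1).+1)%N by lia.
have km : (2 * h - j.+1 < m)%N by lia.
have k2h : (2 * h - j.+1 <= 2 * h)%N by lia.
move: (2 * h - j.+1)%N km k2h => k km k2h.
rewrite incl_probS -mulrA ler_peMr ?incl_prob_ge0//.
rewrite !natrB ?(ltnW km)//; last by rewrite ltnW// (leq_trans km).
have kR : k%:R <= 2 * h%:R :> R by rewrite -natrM ler_nat.
have k0 := ler0n R k.
rewrite mulf_div ler_pdivlMr ?mulr_gt0 ?subr_gt0//; last lra.
by rewrite mul1r mulrC; apply: ler_pM; lra.
Qed.

Lemma incl_prob_sub j : Q (2 * h - j) <= Q (2 * h) * t ^+ j.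
Proof.
have hmR : 2 * h%:R < m%:R :> R by rewrite -natrM ltr_nat.
have maR : m%:R <= a%:R :> R by rewrite ler_nat.
elim: j => [|j IH]; first by rewrite subn0 mulr1.
apply: le_trans (incl_prob_pred _) _.
by rewrite exprSr mulrA ler_wpM2r// divr_ge0//; lra.
Qed.

(** Asking for [h] more points costs slightly more once [h] points are known
    to be included; compare factor by factor with [1 - x <= exp (- x)]. *)
Lemma incl_prob_double :
  Q (2 * h) <= Q h ^+ 2
     * expR (- (h%:R ^+ 2 / m%:R) + h%:R ^+ 2 / (a%:R - 2 * h%:R)).
Proof.
have hmR : 2 * h%:R < m%:R :> R by rewrite -natrM ltr_nat.
have maR : m%:R <= a%:R :> R by rewrite ler_nat.
set u : R := - (h%:R / m%:R) + h%:R / (a%:R - 2 * h%:R).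
have h0 := ler0n R h.
suff H k : (k <= h)%N -> Q (h + k) <= Q h * Q k * expR (k%:R * u).
  have -> : (2 * h = h + h)%N by lia.
  by apply: le_trans (H h _) _ => //; rewrite expr2 /u mulrDr mulrN !mulrA expr2.
elim: k => [_|k IH kh].
  by rewrite addn0 mul0r expR0 mulr1 {3}/incl_prob !ffactn0 divr1 mulr1.
rewrite addnS !incl_probS.
have -> : k.+1%:R * u = k%:R * u + u by rewrite -natr1; ring.
rewrite expRD [leRHS](_ : _ = Q h * Q k * expR (k%:R * u) *
  ((m - k)%:R / (a - k)%:R * expR u)); last by ring.
apply: ler_pM; rewrite ?incl_prob_ge0 ?divr_ge0//.
  by apply: IH; exact: ltnW.
have kR : k%:R <= h%:R :> R by rewrite ler_nat ltnW.
have k0 := ler0n R k.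
rewrite !natrB ?natrD; try lia.
rewrite ler_pdivrMr; last lra.
rewrite expRD; set e1 := expR (- _); set e2 := expR (_ / (_ - _)).
have H1 : m%:R - (h%:R + k%:R) <= (m%:R - k%:R) * e1.
  have m0 : 0 < m%:R :> R by lra.
  apply: (@le_trans _ _ ((m%:R - k%:R) * (1 - h%:R / m%:R))); last first.
    by rewrite ler_wpM2l//; [lra|exact: expR_ge1Dx].
  have -> : (m%:R - k%:R) * (1 - h%:R / m%:R) = m%:R - (h%:R + k%:R) + k%:R * h%:R / m%:R :> R.
    by field; rewrite gt_eqF.
  by rewrite lerDl divr_ge0// mulr_ge0.
have H2 : a%:R - k%:R <= (a%:R - (h%:R + k%:R)) * e2.
  have d0 : 0 < a%:R - 2 * h%:R :> R by lra.
  apply: (@le_trans _ _ ((a%:R - (h%:R + k%:R)) * (1 + h%:R / (a%:R - 2 * h%:R)))); last first.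
    by rewrite ler_wpM2l//; [lra|exact: expR_ge1Dx].
  have -> : (a%:R - (h%:R + k%:R)) * (1 + h%:R / (a%:R - 2 * h%:R)) = a%:R - k%:R +
     (h%:R - k%:R) * h%:R / (a%:R - 2 * h%:R) :> R by field; rewrite gt_eqF.
  by rewrite lerDl divr_ge0 ?mulr_ge0//; lra.
have e10 : 0 <= e1 := expR_ge0 _.
have A0 : 0 < a%:R - k%:R :> R by lra.
have H3 : 1 <= (a%:R - (h%:R + k%:R)) * e2 / (a%:R - k%:R).
  by rewrite ler_pdivlMr// mul1r.
rewrite [leRHS](_ : _ = (m%:R - k%:R) * e1 *
  ((a%:R - (h%:R + k%:R)) * e2 / (a%:R - k%:R))); last by field; rewrite gt_eqF.
by apply: (le_trans H1); rewrite ler_peMr// mulr_ge0//; lra.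
Qed.

End InclProbBounds.

(** * The second moment *)

Section SecondMoment.
Variable R : realType.

Lemma ratio_chain_le (f : nat -> R) (c : R) (J : nat) :
  0 <= c -> (forall j, (j < J)%N -> f j.+1 <= f j * (c / j.+1%:R)) ->
  forall j, (j <= J)%N -> f j <= f 0 * (c ^+ j / j`!%:R).
Proof.
move=> c0 H; elim=> [_|j IH jJ]; first by rewrite expr0 divr1 mulr1.
apply: le_trans (H _ jJ) _.
have -> : f 0 * (c ^+ j.+1 / j.+1`!%:R) = f 0 * (c ^+ j / j`!%:R) * (c / j.+1%:R).
  by rewrite exprSr factS natrM invfM; ring.
by rewrite ler_wpM2r ?IH ?divr_ge0// ltnW.
Qed.

Lemma ratio_chain_ge (f : nat -> R) (c : R) (J : nat) :
  0 <= c -> (forall j, (j < J)%N -> f j * (c / j.+1%:R) <= f j.+1) ->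
  forall j, (j <= J)%N -> f 0 * (c ^+ j / j`!%:R) <= f j.
Proof.
move=> c0 H j jJ; rewrite -lerN2 -mulNr.
apply: (@ratio_chain_le (fun j => - f j) c J) => // i iJ.
by rewrite mulNr lerN2 H.
Qed.

Lemma geometric_tail_le (g : nat -> R) (P : pred nat) (J k : nat) :
  0 <= g J -> (forall j, P j.+1 -> P j) ->
  (forall j, (J <= j)%N -> P j.+1 -> g j.+1 <= g j * (2 / 3)) ->
  \sum_(i < k | P (J + i.+1)%N) g (J + i.+1)%N <= 2 * g J.
Proof.
move=> g0 Pd gP.
have gi i : P (J + i)%N -> g (J + i)%N <= g J * (2 / 3) ^+ i.
  elim: i => [|i IH]; first by rewrite addn0 mulr1.
  rewrite addnS => Pi; apply: le_trans (gP _ (leq_addr _ _) Pi) _.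
  rewrite exprSr [leRHS]mulrA; apply: ler_wpM2r; first lra.
  exact/IH/Pd.
apply: (@le_trans _ _ (\sum_(i < k) g J * (2 / 3) ^+ i.+1)).
  rewrite big_mkcond; apply: ler_sum => i _; case: ifP => [/gi//|_].
  by rewrite mulr_ge0// exprn_ge0//; lra.
have -> : \sum_(i < k) g J * (2 / 3) ^+ i.+1 = (2 - 2 * (2 / 3) ^+ k) * g J.
  elim: k => [|k IH]; first by rewrite big_ord0 expr0; ring.
  by rewrite big_ord_recr /= IH exprS; field.
rewrite ler_wpM2r// gerBl mulr_ge0// exprn_ge0//; lra.
Qed.

(** The bookkeeping of the exponents: [s t (1 + e)] and [s (1 - e)] are the
    perturbed Poisson means, [- rho + h ^ 2 / (a - 2 h)] comes from
    [incl_prob_double]. *)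
Lemma second_moment_exponents (h m a e w : R) :
  let s := h ^+ 2 / a in let rho := h ^+ 2 / m in let t := a / (m - 2 * h) in
  1 <= h -> 8 * h <= m -> m <= a -> 0 <= e <= 1 ->
  rho * e <= w -> h ^+ 3 / m ^+ 2 <= w ->
  [/\ s <= rho, s * t <= 4 / 3 * rho &
     - rho + h ^+ 2 / (a - 2 * h) + s * t * (1 + e) <= s * (1 - e) + 10 * w].
Proof.
move=> s rho t h1 hm ma /andP[e0 e1] rew; set c3 := h ^+ 3 / m ^+ 2 => c3w.
have m0 : 0 < m by lra.
have a0 : 0 < a by lra.
have mh0 : 0 < m - 2 * h by lra.
have ah0 : 0 < a - 2 * h by lra.
have h20 : 0 <= h ^+ 2 by rewrite exprn_ge0//; lra.
have h30 : 0 <= h ^+ 3 by rewrite exprn_ge0//; lra.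
have srho : s <= rho by rewrite /s /rho ler_wpM2l// lef_pV2 ?posrE.
pose D := 2 * h ^+ 3 / (m * (m - 2 * h)).
have D0 : 0 <= D by apply: divr_ge0; apply: mulr_ge0 => //; exact: ltW.
have corr : D <= 8 / 3 * c3.
  rewrite /D /c3 -subr_ge0.
  have -> : 8 / 3 * (h ^+ 3 / m ^+ 2) - 2 * h ^+ 3 / (m * (m - 2 * h))
     = h ^+ 3 * (2 * m - 16 * h) / (3 * m ^+ 2 * (m - 2 * h)).
    by field; rewrite !gt_eqF.
  apply: divr_ge0; first by rewrite mulr_ge0//; clear -hm; lra.
  by rewrite !mulr_ge0 ?exprn_ge0// ltW.
have st : s * t = rho + D.
  by rewrite /s /t /rho /D; field; rewrite !gt_eqF.
have corr2 : h ^+ 2 / (a - 2 * h) <= s + D.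
  rewrite -lerBlDl; apply: (@le_trans _ _ (2 * h ^+ 3 / (a * (a - 2 * h)))).
    by rewrite le_eqVlt; apply/orP; left; apply/eqP; rewrite /s; field; rewrite !gt_eqF.
  rewrite /D ler_wpM2l//; first by rewrite mulr_ge0.
  rewrite lef_pV2 ?posrE ?mulr_gt0//.
  by apply: ler_pM => //; [exact: ltW|exact: ltW|rewrite lerD2r].
have D13 : D <= 1 / 3 * rho.
  rewrite /D /rho -subr_ge0.
  have -> : 1 / 3 * (h ^+ 2 / m) - 2 * h ^+ 3 / (m * (m - 2 * h)) =
     h ^+ 2 * (m - 8 * h) / (3 * m * (m - 2 * h)).
    by field; rewrite !gt_eqF.
  apply: divr_ge0; first by rewrite mulr_ge0//; clear -hm; lra.
  by rewrite !mulr_ge0// ltW.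
split => //; first by rewrite st; clear -D13; lra.
have se : s * e <= rho * e by rewrite ler_wpM2r.
have De : D * e <= D by rewrite ler_piMr.
have -> : s * (1 - e) = s - s * e by ring.
have -> : s * t * (1 + e) = rho + D + rho * e + D * e by rewrite st; ring.
clear -se De corr c3w corr2 rew; lra.
Qed.

(** The factor [1 + 2 w] is the price of the upper tail, [1 - w] that of the lower
    one, and [exp (10 w)] comes from [second_moment_exponents]. *)
Lemma expR_slack (w : R) : 0 <= w -> w <= 1 / 100 ->
  expR (10 * w) * (1 + 2 * w) <= (1 + 19 * w) * (1 - w).
Proof.
move=> w0 w1.
have E10 : expR (10 * w) * (1 - 10 * w) <= 1.
  rewrite -ler_pdivlMr; last lra.
  rewrite mul1r -[leLHS]invrK lef_pV2 ?posrE ?invr_gt0 ?expR_gt0//; last lra.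
  by rewrite -expRN; apply: le_trans (expR_ge1Dx _).
apply: (@le_trans _ _ (expR (10 * w) * ((1 + 19 * w) * (1 - w) * (1 - 10 * w)))).
  by rewrite ler_wpM2l ?expR_ge0//; nra.
by rewrite mulrCA ler_piMr//; nra.
Qed.

(** The overlap counts [f] are compared with a Poisson law of mean
    [s = h ^ 2 / a]. Weighted by the inclusion probabilities, which grow by about
    [a / m] with each common arc, they resemble a Poisson law of mean
    [h ^ 2 / m], and the factor [exp (h ^ 2 / m - h ^ 2 / a)] gained
    in this way is the one lost in [incl_prob_double]. *)
Lemma second_moment_le (a m h J : nat) (f : nat -> R) (P : pred nat)
    (K e w s2 : R) :
  let s := h%:R ^+ 2 / a%:R in
  let rho := h%:R ^+ 2 / m%:R in
  (0 < h)%N -> (8 * h <= m)%N -> (m <= a)%N ->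
  (forall j, 0 <= f j) -> 0 <= e <= 1 ->
  (forall j, (j < J)%N ->
    f j * (s * (1 - e) / j.+1%:R) <= f j.+1 <= f j * (s * (1 + e) / j.+1%:R)) ->
  (forall j, P j.+1 -> P j) ->
  (forall j, (J <= j)%N -> P j.+1 -> f j.+1 <= f j * (m%:R / (2 * a%:R))) ->
  \sum_(j < J.+1) f j <= s2 ->
  \sum_(j < h.+1 | ~~ P j) f j <= w * (incl_prob R a m h * s2) ->
  rho * e <= w -> h%:R ^+ 3 / m%:R ^+ 2 <= w ->
  expR (1 - (K - 8) * rho) <= w -> K * rho - 1 <= J%:R -> 8 <= K ->
  w <= 1 / 100 ->
  \sum_(j < h.+1) f j * incl_prob R a m (2 * h - j)
    <= (1 + 20 * w) * (s2 * incl_prob R a m h ^+ 2).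
Proof.
move=> s rho h0 h8 ma f0 /andP[e0 e1] Hf Pd Hmid Hs2 Htail rew hmw expw KJ K8 w100.
have h2m : (2 * h < m)%N by rewrite (leq_trans _ h8)// ltn_mul2r h0.
set Q := incl_prob R a m.
have Q0 k : 0 <= Q k by exact: incl_prob_ge0.
have hr1 : 1 <= h%:R :> R by rewrite ler1n.
have hm8 : 8 * h%:R <= m%:R :> R by rewrite -natrM ler_nat.
have mar : m%:R <= a%:R :> R by rewrite ler_nat.
have [srho] := second_moment_exponents hr1 hm8 mar (introT andP (conj e0 e1)) rew hmw.
rewrite -/s -/rho; set t := _ / (_ - _) => st43 hexp.
have mh0 : 0 < m%:R - 2 * h%:R :> R by clear -hr1 hm8; lra.
have a0 : 0 < a%:R :> R by clear -hr1 hm8 mar; lra.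
have w0 : 0 <= w by apply: le_trans expw; exact: expR_ge0.
have rho0 : 0 <= rho by rewrite divr_ge0// exprn_ge0.
have s0 : 0 <= s by rewrite divr_ge0// exprn_ge0.
have t0 : 0 <= t by apply: divr_ge0 => //; exact: ltW.
pose tau := s * t * (1 + e).
pose x := s * (1 - e).
have e1m : 0 <= 1 - e by clear -e1; lra.
have e1p : 0 <= 1 + e by clear -e0; lra.
have e2p : 1 + e <= 2 by clear -e1; lra.
have tau0 : 0 <= tau by apply: mulr_ge0 => //; exact: mulr_ge0.
have tau83 : tau <= 8 / 3 * rho.
  apply: (@le_trans _ _ (4 / 3 * rho * 2)); last by clear; lra.
  by apply: ler_pM => //; exact: mulr_ge0.
have x0 : 0 <= x by apply: mulr_ge0.
have xrho : x <= rho by apply: le_trans srho; rewrite /x ler_piMr//; clear -e0; lra.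
have fJ j : (j <= J)%N -> f j <= f 0%N * ((s * (1 + e)) ^+ j / j`!%:R).
  apply: ratio_chain_le; first exact: mulr_ge0.
  by move=> i /Hf/andP[].
have fJ' j : (j <= J)%N -> f 0%N * (x ^+ j / j`!%:R) <= f j.
  apply: ratio_chain_ge => //; by move=> i /Hf/andP[].
pose g j := f j * Q (2 * h - j)%N.
have g0 j : 0 <= g j by rewrite mulr_ge0.
pose C := f 0%N * Q (2 * h)%N.
have C0 : 0 <= C by rewrite mulr_ge0.
have gJ j : (j <= J)%N -> g j <= C * (tau ^+ j / j`!%:R).
  move=> jJ; apply: (@le_trans _ _ (f 0%N * ((s * (1 + e)) ^+ j / j`!%:R) * (Q (2 * h)%N * t ^+ j))).
    by apply: ler_pM => //; [exact: fJ|exact: incl_prob_sub].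
  have -> : tau = s * (1 + e) * t by rewrite /tau; ring.
  by rewrite [in leRHS]exprMn le_eqVlt; apply/orP; left; apply/eqP; rewrite /C; ring.
have gmid j : (J <= j)%N -> P j.+1 -> g j.+1 <= g j * (2 / 3).
  move=> Jj Pj; apply: (@le_trans _ _ (f j * (m%:R / (2 * a%:R)) * (Q (2 * h - j)%N * t))).
    by apply: ler_pM => //; [exact: Hmid|exact: incl_prob_pred].
  rewrite mulrACA -/(g j) ler_wpM2l// /t -subr_ge0.
  have -> : 2 / 3 - m%:R / (2 * a%:R) * (a%:R / (m%:R - 2 * h%:R)) =
     (m%:R - 8 * h%:R) / (6 * (m%:R - 2 * h%:R)) :> R.
    by field; rewrite !gt_eqF.
  by apply: divr_ge0; [rewrite subr_ge0|apply: mulr_ge0 => //; exact: ltW].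
have expJ (y : R) : 4 * y - J%:R <= y + (1 - (K - 8) * rho) ->
    expR (4 * y - J%:R) <= expR y * w.
  move=> le1; apply: (@le_trans _ _ (expR (y + (1 - (K - 8) * rho)))).
    by rewrite ler_expR.
  by rewrite expRD ler_wpM2l ?expR_ge0.
(* [3 tau <= 8 rho] is where the [8] in [K - 8] comes from. *)
have tauJ : expR (4 * tau - J%:R) <= expR tau * w by apply: expJ; clear -tau83 KJ rho0; lra.
have xJ : expR (4 * x - J%:R) <= expR x * w by apply: expJ; clear -xrho KJ rho0; lra.
have sumP : \sum_(j < h.+1 | P j) g j <= C * (expR tau * (1 + 2 * w)).
  apply: (@le_trans _ _ (\sum_(j < J.+1) g j + \sum_(i < h.+1 | P (J + i.+1)%N) g (J + i.+1)%N)).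
    rewrite -(big_mkord P g) -(big_mkord xpredT g).
    rewrite -(big_mkord (fun i => P (J + i.+1)%N) (fun i => g (J + i.+1)%N)).
    have -> : \sum_(0 <= i < h.+1 | P (J + i.+1)%N) g (J + i.+1)%N =
       \sum_(J.+1 <= i < J.+1 + h.+1 | P i) g i.
      rewrite addnC -{1}(add0n J.+1) big_addn addnK.
      apply: eq_big => [i|i _]; by rewrite addnS addnC addnS.
    apply: (@le_trans _ _ (\sum_(0 <= j < J.+1 + h.+1 | P j) g j)).
      rewrite [leRHS](@big_cat_nat _ _ _ h.+1) ?leq_addl//=.
      by rewrite lerDl sumr_ge0.
    rewrite [leLHS](@big_cat_nat _ _ _ J.+1) ?leq_addr//= lerD2r.
    by rewrite big_mkcond ler_sum// => i _; case: ifP.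
  apply: (@le_trans _ _ (C * exp_psum J.+1 tau + 2 * (C * expR (4 * tau - J%:R)))).
    apply: lerD.
      by rewrite /exp_psum mulr_sumr ler_sum// => j _; apply: gJ; rewrite -ltnS.
    apply: le_trans (geometric_tail_le _ _ Pd gmid) _ => //.
    rewrite ler_wpM2l//; apply: le_trans (gJ _ (leqnn J)) _.
    by rewrite ler_wpM2l// exp_term_le.
  have := ler_wpM2l C0 (exp_psum_le J.+1 tau0).
  have := ler_wpM2l C0 tauJ; clear; lra.
have Slow : f 0%N * (expR x * (1 - w)) <= s2.
  apply: le_trans Hs2; apply: (@le_trans _ _ (f 0%N * exp_psum J.+1 x)).
    by rewrite ler_wpM2l//; apply: le_trans (exp_psum_ge J x0); clear -xJ; lra.
  by rewrite /exp_psum mulr_sumr ler_sum// => j _; apply: fJ'; rewrite -ltnS.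
have s20 : 0 <= s2 by apply: le_trans Hs2; exact: sumr_ge0.
have tail : \sum_(j < h.+1 | ~~ P j) g j <= w * (s2 * Q h ^+ 2).
  apply: (@le_trans _ _ (\sum_(j < h.+1 | ~~ P j) f j * Q h)).
    apply: ler_sum => j _; rewrite ler_wpM2l// incl_prob_antitone//.
    by have := ltn_ord j; clear; lia.
  rewrite -mulr_suml; apply: (@le_trans _ _ (w * (Q h * s2) * Q h)).
    by rewrite ler_wpM2r.
  by clear; lra.
have Cle : C * expR tau <= f 0%N * expR x * Q h ^+ 2 * expR (10 * w).
  pose v := - rho + h%:R ^+ 2 / (a%:R - 2 * h%:R).
  apply: (@le_trans _ _ (f 0%N * (Q h ^+ 2 * expR v) * expR tau)).
    by rewrite ler_wpM2r ?expR_ge0// ler_wpM2l// incl_prob_double.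
  have -> : f 0%N * (Q h ^+ 2 * expR v) * expR tau
     = f 0%N * Q h ^+ 2 * expR (v + tau) by rewrite (expRD v tau); ring.
  have -> : f 0%N * expR x * Q h ^+ 2 * expR (10 * w) =
     f 0%N * Q h ^+ 2 * expR (x + 10 * w) by rewrite (expRD x (10 * w)); ring.
  by rewrite ler_wpM2l ?mulr_ge0 ?exprn_ge0// ler_expR.
rewrite (bigID (fun j : 'I_h.+1 => P j)) /=.
pose U := s2 * Q h ^+ 2.
have w2 : 0 <= 1 + 2 * w by clear -w0; lra.
have w19 : 0 <= 1 + 19 * w by clear -w0; lra.
have main : C * (expR tau * (1 + 2 * w)) <= (1 + 19 * w) * U.
  have F0 : 0 <= f 0%N * expR x * Q h ^+ 2 by rewrite !mulr_ge0 ?exprn_ge0 ?expR_ge0.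
  rewrite mulrA; apply: (le_trans (ler_wpM2r w2 Cle)).
  rewrite -[leLHS]mulrA; apply: (le_trans (ler_wpM2l F0 (expR_slack w0 w100))).
  rewrite [leLHS](_ : _ = (1 + 19 * w) * (f 0%N * (expR x * (1 - w)) * Q h ^+ 2)); last by ring.
  by apply: ler_wpM2l => //; apply: ler_wpM2r => //; exact: exprn_ge0.
apply: (le_trans (lerD sumP tail)); rewrite -/U; clear -main; lra.
Qed.

End SecondMoment.

(** * Concentration for a given number of arcs *)

Lemma nbshare_set0 (n : nat) (S : {set digraph n}) (j : nat) :
  nbshare S j <> 0%N -> S != finset.set0.
Proof.
by apply: contra_notN => /eqP ->; apply: eq_card0 => H; rewrite !inE.
Qed.

Lemma nbshare_succ (R : realType) (n : nat) (S : {set digraph n}) (j : nat) :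
  nbshare S j <> 0%N ->
  (nbshare S j.+1)%:R = (nbshare S j)%:R * share_ratio R S j.+1.
Proof.
by move=> /eqP f0; rewrite /share_ratio /= mulrC divfK// pnatr_eq0.
Qed.

(** [second_moment_le] for the overlap counts of [S]. The constant [K] makes the
    Poisson tails beyond [K rho] smaller than [w], because [rho >= k^-1]. *)
Lemma Pr_nbcopies_dev_le (R : realType) (n m h : nat) (S : {set digraph n})
    (gamma : R) (e : R) (delta : nat -> R) (k K w eps : R) :
  let rho : R := h%:R ^+ 2 / m%:R in
  (forall H, H \in S -> #|H| = h) -> (0 < m <= 2 * nbpairs n)%N ->
  0 < k -> 0 < w <= 1 / 100 -> 0 < eps -> 8 + k * (1 - ln w) <= K ->
  (8 * h%:R) ^+ 3 <= m%:R ^+ 2 :> R -> h%:R ^+ 3 <= w * m%:R ^+ 2 ->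
  m%:R <= k * h%:R ^+ 2 ->
  `|e| <= w * (m%:R / h%:R ^+ 2) -> `|e| <= k^-1 * (m%:R / h%:R ^+ 2) ->
  (forall j : nat, (1 <= j)%N -> j%:R <= K * rho ->
    [/\ `|delta j| <= e, nbshare S j.-1 <> 0%N &
        share_ratio R S j =
          h%:R ^+ 2 / (2 * (nbpairs n)%:R * j%:R) * (1 + delta j)]) ->
  (forall j : nat, (1 <= j)%N -> 4 * rho <= j%:R -> j%:R <= gamma ->
    (nbshare S j.-1 <> 0%N -> share_ratio R S j <= m%:R / (4 * (nbpairs n)%:R)) /\
    (nbshare S j.-1 = 0%N -> nbshare S j = 0%N)) ->
  \sum_(0 <= j < h.+1 | gamma < j%:R) (nbshare S j)%:R
    <= w * (mean_formula R S h m * #|S|%:R) ->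
  Pr (@Dnm R n m) (fun G => eps < `|(nbcopies S G)%:R
     / Ex (@Dnm R n m) (fun G' => (nbcopies S G')%:R) - 1|) <= 20 * w / eps ^+ 2.
Proof.
move=> rho hS /andP[mn0 maN] k0 /andP[w0 w1] eps0 Kge h3 hw mk ew ek Ha Hb Hc.
have lnw : ln w <= 0 by apply: ln_le0; apply: (le_trans w1); clear; lra.
have lnw1 : 1 <= 1 - ln w by clear -lnw; lra.
have K8 : 8 <= K.
  apply: le_trans Kge; rewrite lerDl mulr_ge0 ?ltW//.
  exact: lt_le_trans ltr01 lnw1.
have Kk : k * (1 - ln w) <= K - 8 by clear -Kge; lra.
have K0 : 0 < K by apply: lt_le_trans K8.
have mR : 1 <= m%:R :> R by rewrite ler1n.
have m0 : 0 < m%:R :> R by rewrite ltr0n.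
have hn0 : (0 < h)%N.
  rewrite lt0n; apply/negP => /eqP h0; move: mk.
  by rewrite h0 expr0n /= mulr0 leNgt m0.
have hR : 0 < h%:R :> R by rewrite ltr0n.
have h2R : 0 < h%:R ^+ 2 :> R by rewrite exprn_gt0.
have rho_k : k^-1 <= rho by rewrite /rho ler_pdivlMr ?ler_pdivrMl.
have rho0 : 0 < rho by apply: lt_le_trans rho_k; rewrite invr_gt0.
have krho : 1 <= k * rho by rewrite -ler_pdivrMl// mulr1.
have h8 : (8 * h <= m)%N.
  rewrite leqNgt; apply/negP; rewrite -(ltr_nat R) natrM => lt.
  have H1 : m%:R ^+ 3 < (8 * h%:R) ^+ 3 :> R by rewrite ltrXn2r// ltW.
  have H2 : m%:R ^+ 2 <= m%:R ^+ 3 :> R by rewrite ler_weXn2l.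
  by have := lt_le_trans H1 (le_trans h3 H2); rewrite ltxx.
have hm : (h <= m)%N by clear -h8; lia.
have hmw : h%:R ^+ 3 / m%:R ^+ 2 <= w by rewrite ler_pdivrMr ?exprn_gt0.
have rhoV : rho * (m%:R / h%:R ^+ 2) = 1 by rewrite /rho; field; rewrite !gt_eqF.
have rew : rho * `|e| <= w.
  by rewrite -[leRHS]mulr1 -rhoV [leRHS]mulrCA; apply: ler_wpM2l => //; exact: ltW.
have e1 : `|e| <= 1.
  have : rho * `|e| <= k^-1.
    by rewrite -[leRHS]mulr1 -rhoV [leRHS]mulrCA; apply: ler_wpM2l => //; exact: ltW.
  have : k^-1 * `|e| <= rho * `|e| by rewrite ler_wpM2r.
  by move=> H1 H2; have := le_trans H1 H2; rewrite ger_pMr// invr_gt0.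
(* By the choice of [K] the exponent is at most [ln w]. *)
have expw : expR (1 - (K - 8) * rho) <= w.
  rewrite -[leRHS](@lnK R) ?posrE// ler_expR.
  have H1 : k * (1 - ln w) * rho <= (K - 8) * rho by rewrite ler_wpM2r// ltW.
  have : 1 - ln w <= k * (1 - ln w) * rho.
    by rewrite mulrAC ler_peMl// (le_trans ler01).
  by clear -H1; lra.
have Krho0 : 0 <= K * rho by rewrite mulr_ge0// ltW.
pose J := Num.truncn (K * rho).
have /andP[JK KJ1] : J%:R <= K * rho < J.+1%:R by exact: truncn_itv.
have S0 : S != finset.set0.
  have [] := Ha 1%N isT => [|_ /nbshare_set0//].
  apply: (le_trans krho); apply: ler_wpM2r; first exact: ltW.
  apply: le_trans (ler_peMr (ltW k0) lnw1) _; apply: (le_trans Kk).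
  by rewrite gerBl.
pose f j : R := (nbshare S j)%:R.
have f0 j : 0 <= f j by exact: ler0n.
pose P : pred nat := fun j => j%:R <= gamma.
have aE : (2 * nbpairs n)%:R = 2 * (nbpairs n)%:R :> R by rewrite natrM.
have step j : (j < J)%N ->
   f j * (h%:R ^+ 2 / (2 * nbpairs n)%:R * (1 - `|e|) / j.+1%:R) <= f j.+1
   <= f j * (h%:R ^+ 2 / (2 * nbpairs n)%:R * (1 + `|e|) / j.+1%:R).
  move=> jJ; have [|dle fj r] := Ha j.+1 isT.
    by apply: le_trans JK; rewrite ler_nat.
  rewrite /f (nbshare_succ R fj) r aE.
  have /ler_normlP[d1 d2] : `|delta j.+1| <= `|e| by apply: le_trans dle (ler_norm _).
  have c0 : 0 <= h%:R ^+ 2 / (2 * (nbpairs n)%:R * j.+1%:R) :> R.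
    by rewrite divr_ge0 ?mulr_ge0// ltW.
  have E x : h%:R ^+ 2 / (2 * (nbpairs n)%:R) * x / j.+1%:R =
      h%:R ^+ 2 / (2 * (nbpairs n)%:R * j.+1%:R) * x :> R.
    by rewrite [in RHS]invfM; ring.
  rewrite !E; apply/andP; split; rewrite ler_wpM2l// ler_wpM2l//; clear -d1 d2; lra.
have Pd j : P j.+1 -> P j by apply: le_trans; rewrite ler_nat.
have mid j : (J <= j)%N -> P j.+1 -> f j.+1 <= f j * (m%:R / (2 * (2 * nbpairs n)%:R)).
  move=> Jj Pj; have [|H1 H2] := Hb j.+1 isT _ Pj.
    apply: (@le_trans _ _ (K * rho)).
      rewrite ler_wpM2r ?(ltW rho0)//; clear -K8; lra.
    by apply: ltW (lt_le_trans KJ1 _); rewrite ler_nat.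
  rewrite /f; have [/H2 ->|/eqP fj] := eqVneq (nbshare S j) 0%N.
    by rewrite mulr_ge0// divr_ge0.
  rewrite (nbshare_succ R fj) ler_wpM2l//; apply: le_trans (H1 fj) _.
  rewrite aE mulrA le_eqVlt; apply/orP; left; apply/eqP; congr (_ / (_ * _)).
  by clear; ring.
have sumf : \sum_(j < J.+1) f j <= #|S|%:R ^+ 2.
  by rewrite /f -natr_sum -natrX ler_nat sum_nbshare_le.
have tailf : \sum_(j < h.+1 | ~~ P j) f j
    <= w * (incl_prob R (2 * nbpairs n) m h * #|S|%:R ^+ 2).
  move: Hc; rewrite mean_formulaE// big_mkord; under eq_bigl do rewrite ltNge.
  move=> le; apply: (le_trans le); rewrite le_eqVlt; apply/orP; left; apply/eqP.
  by clear; ring.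
have KJ : K * rho - 1 <= J%:R by rewrite lerBlDr natr1 ltW.
have key := second_moment_le hn0 h8 maN f0 (introT andP (conj (normr_ge0 e) e1))
  step Pd mid sumf tailf rew hmw expw KJ K8 w1.
apply: (Pr_nbcopies_dev maN hS) => //.
by rewrite (Ex_nbcopies_sqr _ maN hS) (Ex_nbcopies _ maN hS) exprMn.
Qed.

(** A second moment argument. The number [K] for which the expansion of the
    ratios is used depends on the precision wanted. *)
Theorem nbcopies_Dnm_concentration (R : realType) (h : nat -> nat)
    (S : forall n : nat, {set digraph n})
    (hS : forall (n : nat) (H : digraph n), H \in S n -> #|H| = h n)
    (m : nat -> nat) (gamma : nat -> R) :
    let rho : nat -> R := fun n => (h n)%:R ^+ 2 / (m n)%:R in
    let mu : nat -> R := fun n => mean_formula R (S n) (h n) (m n) in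
    (forall n : nat, (m n <= 2 * nbpairs n)%N) ->
    (\forall n \near \oo, (0 < m n)%N) ->
    (fun n => (h n)%:R ^+ 3 : R) =o_\oo (fun n => (m n)%:R ^+ 2 : R) ->
    (fun n => (h n)%:R ^+ 2 : R) =Omega_\oo (fun n => (m n)%:R : R) ->
    (forall K : R, 0 < K ->
      exists (e : nat -> R) (delta : nat -> nat -> R),
        e =o_\oo (fun n => (m n)%:R / (h n)%:R ^+ 2 : R) /\
        \forall n \near \oo, forall j : nat,
          (1 <= j)%N -> j%:R <= K * rho n ->
          [/\ `|delta n j| <= e n,
              nbshare (S n) j.-1 <> 0%N &
              share_ratio R (S n) j =
                (h n)%:R ^+ 2 / (2 * (nbpairs n)%:R * j%:R)
                  * (1 + delta n j)]) ->
    (\forall n \near \oo, forall j : nat,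
      (1 <= j)%N -> 4 * rho n <= j%:R -> j%:R <= gamma n ->
      (nbshare (S n) j.-1 <> 0%N ->
         share_ratio R (S n) j <= (m n)%:R / (4 * (nbpairs n)%:R)) /\
      (nbshare (S n) j.-1 = 0%N -> nbshare (S n) j = 0%N)) ->
    (fun n => \sum_(0 <= j < (h n).+1 | gamma n < j%:R)
                (nbshare (S n) j)%:R : R)
      =o_\oo (fun n => mu n * #|S n|%:R : R) ->
    cvg_in_prob (fun n => @Dnm R n (m n))
      (fun n G => (nbcopies (S n) G)%:R
         / Ex (@Dnm R n (m n)) (fun G' => (nbcopies (S n) G')%:R)) 1.
Proof.
move=> rho mu ma mgt0 h3m; rewrite eqOmegaE eqOmegaO => /eqO_exP[k k0 mh2] Ha Hb Hc eps eps0.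
apply/cvgr0Pnorm_le => d d0.
have e20 : 0 < eps ^+ 2 by rewrite exprn_gt0.
(* The deviation bound obtained at precision [w] is [20 w / eps ^ 2]. *)
pose w : R := Num.min (1 / 100) (d * eps ^+ 2 / 20).
have w0 : 0 < w.
  by rewrite /w lt_min; apply/andP; split; rewrite ?divr_gt0 ?mulr_gt0.
have w1 : w <= 1 / 100 by rewrite /w ge_min lexx.
have wd : 20 * w / eps ^+ 2 <= d.
  have : w <= d * eps ^+ 2 / 20 by rewrite /w ge_min lexx orbT.
  by rewrite ler_pdivrMr//; clear; lra.
pose K := 8 + k * (1 - ln w).
have K0 : 0 < K.
  have lnw : ln w <= 0 by apply: ln_le0; apply: (le_trans w1); clear; lra.
  rewrite ltr_wpDr//; apply: mulr_ge0; first exact: ltW.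
  by clear -lnw; lra.
have [e [delta [e_o Ha']]] := Ha _ K0.
have {}h3m t : 0 < t -> \forall n \near \oo, (h n)%:R ^+ 3 <= t * (m n)%:R ^+ 2 :> R.
  move=> t0; move: h3m => /eqoP/(_ t t0); apply: filterS => i.
  by rewrite !ger0_norm ?exprn_ge0.
have {}e_o t : 0 < t -> \forall n \near \oo, `|e n| <= t * ((m n)%:R / (h n)%:R ^+ 2) :> R.
  move=> t0; move: e_o => /eqoP/(_ t t0); apply: filterS => i.
  by rewrite [X in _ <= _ * X]ger0_norm// divr_ge0// exprn_ge0.
have {}mh2 : \forall n \near \oo, (m n)%:R <= k * (h n)%:R ^+ 2 :> R.
  by move: mh2; apply: filterS => i; rewrite !ger0_norm ?exprn_ge0.
have {}Hc : \forall n \near \oo,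
    \sum_(0 <= j < (h n).+1 | gamma n < j%:R) (nbshare (S n) j)%:R <= w * (mu n * #|S n|%:R).
  move: Hc => /eqoP/(_ w w0); apply: filterS => i.
  have mu0 : 0 <= mu i * #|S i|%:R.
    by apply: mulr_ge0 => //; apply: divr_ge0 => //; exact: mulr_ge0.
  by rewrite [X in _ <= _ * X]ger0_norm//; apply: le_trans; exact: ler_norm.
have ki : 0 < k^-1 by rewrite invr_gt0.
have nH1 : \forall n \near \oo, (8 * (h n)%:R) ^+ 3 <= (m n)%:R ^+ 2 :> R.
  have c0 : 0 < (8 ^+ 3)^-1 :> R by rewrite invr_gt0 exprn_gt0.
  move: (h3m _ c0); apply: filterS => i.
  by rewrite exprMn ler_pdivlMl ?exprn_gt0.
have nH2 := h3m _ w0; have nH3 := e_o _ w0; have nH4 := e_o _ ki.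
near=> n.
rewrite ger0_norm; last by apply: Pr_ge0; exact: Dnm_ge0.
apply: (le_trans _ wd).
apply: (@Pr_nbcopies_dev_le R n (m n) (h n) (S n) (gamma n) (e n) (delta n) k K w eps) => //.
- exact: hS.
- by rewrite ma andbT; near: n.
- by rewrite w0.
- by near: n.
- by near: n.
- by near: n.
- by near: n.
- by near: n.
- by near: n.
- by near: n.
- by near: n.
Unshelve. all: by end_near.
Qed.

(** * The distribution function of the standard normal law *)

Section StandardNormal.
Variable R : realType.
Implicit Types (a b c x : R).

Definition normal_cdf x : R := fine (normal_prob 0 1 (`]-oo, x]%classic : set R)).
Local Notation Phi := normal_cdf.

Let N01 : probability (measurableTypeR R) R := normal_prob 0 1.

Lemma normal_cdfE x : N01 `]-oo, x]%classic = (Phi x)%:E.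
Proof. by rewrite fineK// fin_num_measure. Qed.

Lemma normal_cdf_ge0 x : 0 <= Phi x.
Proof. by rewrite fine_ge0. Qed.

Lemma normal_cdf_le1 x : Phi x <= 1.
Proof. by rewrite -lee_fin -normal_cdfE probability_le1. Qed.

Lemma normal_cdf_itv a b : a <= b -> N01 `]a, b]%classic = (Phi b - Phi a)%:E.
Proof.
move=> ab.
have E : N01 `]-oo, b]%classic = (N01 `]-oo, a]%classic + N01 `]a, b]%classic)%E.
  rewrite -measureU//; first by rewrite -itv_bndbnd_setU// bnd_simp.
  apply/seteqP; split => // x [] /=; rewrite !in_itv /= => xa /andP[ax _].
  by move: (lt_le_trans ax xa); rewrite ltxx.
move: E; rewrite !normal_cdfE -[N01 `]a, b]%classic]fineK ?fin_num_measure//.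
by rewrite -EFinD => -[->]; rewrite addrC addKr.
Qed.

Lemma normal_cdf_diff_bounds a b (lo hi : R) : a <= b -> 0 <= lo ->
  (forall x, a <= x <= b -> lo <= normal_pdf 0 1 x <= hi) ->
  lo * (b - a) <= Phi b - Phi a <= hi * (b - a).
Proof.
move=> ab lo0 H; rewrite -!lee_fin -normal_cdf_itv//.
have leb : @lebesgue_measure R `]a, b]%classic = (b - a)%:E.
  rewrite lebesgue_measure_itv /= lte_fin.
  by case: ltP => [//|ba]; rewrite (@le_anti _ _ a b) ?subrr// ab.
have cst c : (c * (b - a))%:E = (\int[lebesgue_measure]_(x in `]a, b]%classic) (cst c%:E x))%E.
  by rewrite integral_cst// [X in (_ * X)%E](_ : _ = (b - a)%:E).
have Hi x : (`]a, b]%classic : set R) x -> lo <= normal_pdf 0 1 x <= hi.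
  by move=> /=; rewrite in_itv /= => /andP[/ltW ax xb]; apply: H; rewrite ax.
rewrite !cst /N01 /normal_prob; apply/andP; split; apply: ge0_le_integral => //.
- by apply/measurable_EFinP; apply: measurable_funTS; exact: measurable_normal_pdf.
- by move=> x /Hi /andP[lx _]; rewrite lee_fin.
- by move=> x _; rewrite lee_fin normal_pdf_ge0.
- by apply/measurable_EFinP; apply: measurable_funTS; exact: measurable_normal_pdf.
- by move=> x /Hi /andP[_ lh]; rewrite lee_fin.
Qed.

Lemma normal_cdf_mono a b : a <= b -> Phi a <= Phi b.
Proof. by move=> ab; rewrite -subr_ge0 -lee_fin -normal_cdf_itv. Qed.

Lemma normal_cdf_lipschitz a b : a <= b -> Phi b - Phi a <= normal_peak 1 * (b - a).
Proof.
move=> ab; suff /andP[] : 0 * (b - a) <= Phi b - Phi a <= normal_peak 1 * (b - a) by [].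
apply: normal_cdf_diff_bounds => // x _.
by rewrite normal_pdf_ge0 normal_pdf_ub ?oner_eq0.
Qed.

(** Continuity of the measure along the intervals from [- n] to [n]. *)
Lemma normal_cdf_tails (eps : R) : 0 < eps ->
  exists2 K : R, 0 < K & forall L, K <= L -> 1 - eps <= Phi L - Phi (- L).
Proof.
move=> eps0; pose F n : set R := `](- n%:R), n%:R]%classic.
have FT : \bigcup_n F n = setT.
  rewrite -subTset => t _; exists (Num.bound `|t|) => //.
  rewrite /F /= in_itv /=.
  have := ltr_norml t (Num.bound `|t|)%:R; rewrite archi_boundP// => /esym/andP[-> /ltW ->].
  by [].
have cvgF : N01 (F n) @[n --> \oo] --> 1%E.
  rewrite -(@probability_setT _ _ _ N01) -FT; apply: nondecreasing_cvg_mu => //.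
  - by move=> n; exact: measurable_itv.
  - by apply: bigcup_measurable => n _; exact: measurable_itv.
  - move=> n m nm; apply/subsetPset => x; rewrite /F /= !in_itv /= => /andP[nx xn].
    have nmR : n%:R <= m%:R :> R by rewrite ler_nat.
    by rewrite (le_trans xn)// (le_lt_trans _ nx)// lerN2.
have FE n : N01 (F n) = (Phi n%:R - Phi (- n%:R))%:E.
  by rewrite normal_cdf_itv// (le_trans _ (ler0n R n))// oppr_le0.
have cvgR : Phi n%:R - Phi (- n%:R) @[n --> \oo] --> (1 : R).
  have -> : (fun n : nat => Phi n%:R - Phi (- n%:R)) = fine \o (N01 \o F).
    by apply/funext => n /=; rewrite FE.
  exact: fine_cvg.
have /cvgrPdist_le/(_ eps eps0)[M _ HM] := cvgR.
exists M.+1%:R; first by rewrite ltr0n.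
move=> L ML; have := HM M.+1 (leqnSn M).
have := normal_cdf_mono ML.
have : Phi (- L) <= Phi (- M.+1%:R) by apply: normal_cdf_mono; rewrite lerN2.
by move=> ? ?; rewrite ler_norml; lra.
Qed.

End StandardNormal.

(** * Bounds on the logarithm; binomial moments *)

Section ExpBounds.
Variable R : realType.

(** Together with [1 + y <= exp y], a second-order two-sided control of
    [ln (1 + y)]. *)
Lemma expR_le1D (y : R) : - 2^-1 <= y -> expR (y - 2 * y ^+ 2) <= 1 + y.
Proof.
move=> y2; have d0 : 0 < 1 - y + 2 * y ^+ 2 by nra.
rewrite -[leLHS]invrK -expRN -[leRHS]invrK lef_pV2 ?posrE ?invr_gt0 ?expR_gt0//; last by lra.
apply: le_trans (expR_ge1Dx _); rewrite -[leLHS]mul1r ler_pdivrMr; last by lra.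
by rewrite -subr_ge0 [leRHS](_ : _ = y ^+ 2 * (1 + 2 * y)); [rewrite mulr_ge0 ?sqr_ge0//; lra|ring].
Qed.

Lemma ln1D_bounds (y : R) : `|y| <= 2^-1 -> y - 2 * y ^+ 2 <= ln (1 + y) <= y.
Proof.
move=> /ler_normlP[y1 y2]; have y0 : 0 < 1 + y by lra.
rewrite le_ln1Dx ?andbT; last by lra.
by rewrite -ler_expR lnK ?posrE// expR_le1D//; lra.
Qed.

End ExpBounds.

Section BinomialMoments.
Variables (R : realType) (p : R).
Implicit Types (a k : nat) (F : nat -> R).

Definition binom_mass a k : R := 'C(a, k)%:R * p ^+ k * (1 - p) ^+ (a - k).

Definition binom_mean a F : R := \sum_(k < a.+1) binom_mass a k * F k.

(** Condition on the last of [a.+1] trials. *)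
Lemma binom_meanS a F :
  binom_mean a.+1 F = (1 - p) * binom_mean a F + p * binom_mean a (F \o S).
Proof.
rewrite /binom_mean big_ord_recl /=.
have E k : (k < a.+1)%N -> binom_mass a.+1 k.+1 = (1 - p) * binom_mass a k.+1 + p * binom_mass a k.
  rewrite ltnS leq_eqVlt /binom_mass binS natrD exprS => /orP[/eqP ->|ka].
    by rewrite bin_small// subSS; ring.
  by rewrite subSS -(subnSK ka) (exprS (1 - p)); ring.
rewrite (eq_bigr (fun k : 'I_a.+1 => (1 - p) * (binom_mass a k.+1 * F k.+1)
    + p * (binom_mass a k * F k.+1))); last first.
  by move=> k _; rewrite /bump /= add1n E//; ring.
rewrite big_split /= -!mulr_sumr addrA; congr (_ + _).
have -> : binom_mass a.+1 0 = (1 - p) * binom_mass a 0.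
  by rewrite /binom_mass !bin0 !subn0 exprS; ring.
rewrite -mulrA -mulrDr; congr (_ * _).
rewrite big_ord_recr /= [X in _ + (_ + X)](_ : _ = 0) ?addr0; last first.
  by rewrite /binom_mass bin_small// !mul0r.
by rewrite [RHS]big_ord_recl.
Qed.

Lemma binom_mean_eq a F G : F =1 G -> binom_mean a F = binom_mean a G.
Proof. by move=> FG; apply: eq_bigr => k _; rewrite FG. Qed.

Lemma binom_meanD a F G (c : R) :
  binom_mean a (fun k => F k + c * G k) = binom_mean a F + c * binom_mean a G.
Proof.
by rewrite /binom_mean mulr_sumr -big_split; apply: eq_bigr => k _ /=; ring.
Qed.

Lemma binom_mean1 a : binom_mean a (fun=> 1) = 1.
Proof.
elim: a => [|a IH]; last first.
  by rewrite binom_meanS (@binom_mean_eq _ (_ \o S) (fun=> 1))// IH; ring.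
by rewrite /binom_mean big_ord1 /binom_mass bin0 !expr0 !mulr1.
Qed.

Lemma binom_mean_id a : binom_mean a (fun k => k%:R) = a%:R * p.
Proof.
elim: a => [|a IH]; first by rewrite /binom_mean big_ord1 /= mulr0 mul0r.
rewrite binom_meanS (@binom_mean_eq _ (_ \o S) (fun k => k%:R + 1 * 1)); last first.
  by move=> k /=; rewrite -natr1 mulr1.
by rewrite (binom_meanD _ _ (fun=> 1)) binom_mean1 IH -natr1; ring.
Qed.

Lemma binom_mean_sqr a :
  binom_mean a (fun k => k%:R ^+ 2) = a%:R * p * (1 - p) + (a%:R * p) ^+ 2.
Proof.
elim: a => [|a IH].
  by rewrite /binom_mean big_ord1 /= expr0n mulr0 !mul0r expr0n addr0.
rewrite binom_meanS (@binom_mean_eq _ (_ \o S) (fun k => (k%:R ^+ 2 + 2 * k%:R) + 1 * 1)); last first.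
  by move=> k /=; rewrite -natr1; ring.
rewrite (binom_meanD _ _ (fun=> 1)) (binom_meanD _ (fun k => k%:R ^+ 2) (fun k => k%:R)).
by rewrite binom_mean1 binom_mean_id IH -natr1; ring.
Qed.

Lemma binom_variance a :
  binom_mean a (fun k => (k%:R - a%:R * p) ^+ 2) = a%:R * p * (1 - p).
Proof.
rewrite (@binom_mean_eq _ _ (fun k => (k%:R ^+ 2 + (- 2 * (a%:R * p)) * k%:R) + (a%:R * p) ^+ 2 * 1)); last first.
  by move=> k; ring.
rewrite (binom_meanD _ _ (fun=> 1)) (binom_meanD _ (fun k => k%:R ^+ 2) (fun k => k%:R)).
by rewrite binom_mean1 binom_mean_id binom_mean_sqr; ring.
Qed.

Lemma binom_mass_succ a k : (k < a)%N ->
  binom_mass a k.+1 * (k.+1%:R * (1 - p)) = binom_mass a k * ((a%:R - k%:R) * p).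
Proof.
move=> ka; rewrite /binom_mass -(subnSK ka) !exprS -natrB ?(ltnW ka)//.
have /(congr1 (fun n => n%:R : R)) := mul_bin_left a k.
by rewrite !natrM => E; rewrite [LHS](_ : _ = (k.+1%:R * 'C(a, k.+1)%:R) * (p * p ^+ k * (1 - p) * (1 - p) ^+ (a - k.+1))); [rewrite E; ring|ring].
Qed.

End BinomialMoments.

(** * The theorem of de Moivre and Laplace *)

Section DeMoivreLaplace.
Variables (R : realType) (a : nat) (p s : R).
Hypotheses (p01 : 0 < p < 1) (s0 : 0 < s) (sE : s ^+ 2 = a%:R * p * (1 - p)).
Implicit Types (k l : nat) (K t : R).

Local Notation b := (binom_mass p a).
Local Notation Phi := (@normal_cdf R).
Local Notation peak := (@normal_peak R 1).

Definition bstd k : R := (k%:R - a%:R * p) / s.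
Local Notation x := bstd.

Definition cell k : R := Phi (x k.+1) - Phi (x k).

Let p0 : 0 < p. Proof. by case/andP: p01. Qed.
Let q0 : 0 < 1 - p. Proof. by case/andP: p01 => _; rewrite subr_gt0. Qed.

Lemma binom_mass_ge0 k : 0 <= b k.
Proof. by rewrite !mulr_ge0 ?exprn_ge0// ltW. Qed.

Lemma bstdS k : x k.+1 = x k + s^-1.
Proof. by rewrite /bstd -natr1; ring. Qed.

Lemma bstd_le k l : (k <= l)%N -> x k <= x l.
Proof. by move=> kl; rewrite ler_pM2r ?invr_gt0// lerD2r ler_nat. Qed.

Lemma cell_ge0 k : 0 <= cell k.
Proof. by rewrite subr_ge0 normal_cdf_mono// bstd_le. Qed.

Lemma binom_tail K : 0 < K -> \sum_(k < a.+1 | K < `|x k|) b k <= (K ^+ 2)^-1.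
Proof.
move=> K0; have K20 : 0 < K ^+ 2 by rewrite exprn_gt0.
rewrite -[leRHS]mul1r ler_pdivlMr// mulr_suml big_mkcond.
have -> : 1 = binom_mean p a (fun k => (k%:R - a%:R * p) ^+ 2) / s ^+ 2.
  by rewrite binom_variance -sE divff// gt_eqF// exprn_gt0.
rewrite /binom_mean mulr_suml; apply: ler_sum => k _.
have -> : b k * (k%:R - a%:R * p) ^+ 2 / s ^+ 2 = b k * x k ^+ 2.
  by rewrite /bstd expr_div_n; ring.
case: ifP => [lt|_]; last by rewrite mulr_ge0 ?sqr_ge0 ?binom_mass_ge0.
rewrite ler_wpM2l ?binom_mass_ge0// -[leRHS]real_normK ?num_real//.
by rewrite ler_sqr ?nnegrE// ltW.
Qed.

Lemma binom_total : \sum_(k < a.+1) b k = 1.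
Proof.
by rewrite -(binom_mean1 p a) /binom_mean; apply: eq_bigr => k _; rewrite mulr1.
Qed.

(** The binomial mass relative to the normal density, up to a constant. *)
Definition rel_mass k : R := b k * expR (x k ^+ 2 / 2).

Lemma rel_mass_ge0 k : 0 <= rel_mass k.
Proof. by rewrite mulr_ge0 ?binom_mass_ge0 ?expR_ge0. Qed.

(** From [k] to [k + 1] the binomial mass changes by the factor
    [(1 - u) / (1 + v)] with [u + v = x k / s + O (1 / s ^ 2)], and the density by
    [exp (- x k / s - 1 / (2 s ^ 2))]: the first-order terms cancel. *)
Lemma rel_mass_step K k : 0 <= K -> 2 * (K + 1) <= s -> (k < a)%N -> `|x k| <= K ->
  let C := (2 * (K + 1) ^+ 2 + 1) / s ^+ 2 in
  rel_mass k.+1 <= rel_mass k * expR C /\ rel_mass k <= rel_mass k.+1 * expR C.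
Proof.
move=> K0 sK ka xK C.
have [xl xu] : - K <= x k /\ x k <= K by move: xK; rewrite ler_norml => /andP.
pose i : R := s^-1; have i0 : 0 < i by rewrite invr_gt0.
have si : s * i = 1 by rewrite mulfV ?gt_eqF.
have iK : (K + 1) * i <= 2^-1.
  by rewrite ler_pdivrMr//; lra.
pose u := x k * p * i; pose v := x k * (1 - p) * i + (1 - p) * i ^+ 2.
have p1 : p <= 1 by move: q0; lra.
have q1 : 1 - p <= 1 by move: p0; lra.
have i1 : i <= 1.
  have : 1 * i <= (K + 1) * i by rewrite ler_wpM2r ?(ltW i0)//; lra.
  by move: iK; lra.
have xi : `|x k * i| <= K * i by rewrite normrM (gtr0_norm i0) ler_wpM2r// ltW.
have Ki0 : 0 <= K * i by rewrite mulr_ge0// ltW.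
have uK : `|u| <= (K + 1) * i.
  rewrite /u mulrAC normrM (gtr0_norm p0); apply: (@le_trans _ _ (K * i * 1)).
    by apply: ler_pM => //; exact: ltW.
  by lra.
have vK : `|v| <= (K + 1) * i.
  have -> : v = (x k * i + i ^+ 2) * (1 - p) by rewrite /v; ring.
  rewrite normrM (gtr0_norm q0) -[leRHS]mulr1; apply: ler_pM => //; first exact: ltW.
  apply: (le_trans (ler_normD _ _)); rewrite (ger0_norm (sqr_ge0 i)) mulrDl mul1r.
  by apply: lerD => //; rewrite expr2 ler_piMr// ltW.
have sq y : `|y| <= (K + 1) * i -> y ^+ 2 <= (K + 1) ^+ 2 * i ^+ 2.
  move=> yK; rewrite -exprMn -[leLHS]real_normK ?num_real// ler_sqr ?nnegrE//.
  by rewrite mulr_ge0 ?(ltW i0)//; lra.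
have u2 := sq _ uK; have v2 := sq _ vK.
have half y : `|y| <= (K + 1) * i -> - 2^-1 <= y.
  by move=> /ler_normlP[y1 _]; move: iK y1; lra.
have uh := half _ uK; have vh := half _ vK.
have nuh : - 2^-1 <= - u by apply: half; rewrite normrN.
have rec : b k.+1 * (1 + v) = b k * (1 - u).
  have aE : a%:R * p = s ^+ 2 / (1 - p) by rewrite sE; field; rewrite gt_eqF.
  have kE : k%:R = a%:R * p + s * x k by rewrite /bstd; field; rewrite gt_eqF.
  have s2i : s ^+ 2 * i ^+ 2 = 1 by rewrite -exprMn si expr1n.
  have E1 : k.+1%:R * (1 - p) = s ^+ 2 * (1 + v).
    rewrite -natr1 kE aE /v /i; field; rewrite !gt_eqF//.
  have E2 : (a%:R - k%:R) * p = s ^+ 2 * (1 - u).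
    rewrite mulrBl kE aE /u /i; field; rewrite !gt_eqF//.
  have := binom_mass_succ p ka; rewrite E1 E2.
  rewrite !(mulrCA _ (s ^+ 2)) => /(mulfI _); apply.
  by rewrite expf_neq0// gt_eqF.
have up : b k.+1 <= b k * expR (- u - v + 2 * v ^+ 2).
  have -> : - u - v + 2 * v ^+ 2 = - u - (v - 2 * v ^+ 2) by ring.
  rewrite expRB mulrA ler_pdivlMr ?expR_gt0//.
  apply: (@le_trans _ _ (b k.+1 * (1 + v))).
    by rewrite ler_wpM2l ?binom_mass_ge0// expR_le1D.
  by rewrite rec ler_wpM2l ?binom_mass_ge0// expR_ge1Dx.
have dn : b k <= b k.+1 * expR (u + v + 2 * u ^+ 2).
  have -> : u + v + 2 * u ^+ 2 = v - (- u - 2 * (- u) ^+ 2) by ring.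
  rewrite expRB mulrA ler_pdivlMr ?expR_gt0//.
  apply: (@le_trans _ _ (b k * (1 - u))).
    by rewrite ler_wpM2l ?binom_mass_ge0// expR_le1D.
  by rewrite -rec ler_wpM2l ?binom_mass_ge0// expR_ge1Dx.
have x2 : x k.+1 ^+ 2 / 2 = x k ^+ 2 / 2 + x k * i + i ^+ 2 / 2.
  by rewrite bstdS -/i; field.
have CE : C = 2 * ((K + 1) ^+ 2 * i ^+ 2) + i ^+ 2.
  by rewrite /C /i exprVn; ring.
have uvE : u + v = x k * i + (1 - p) * i ^+ 2 by rewrite /u /v; ring.
have i20 : 0 <= i ^+ 2 by exact: sqr_ge0.
have qi : (1 - p) * i ^+ 2 <= i ^+ 2 by rewrite ler_piMl.
have qi0 : 0 <= (1 - p) * i ^+ 2 by rewrite mulr_ge0// ltW.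
rewrite /rel_mass; split.
  apply: (le_trans (ler_wpM2r (expR_ge0 _) up)).
  rewrite -[leLHS]mulrA -[leRHS]mulrA -!expRD ler_wpM2l ?binom_mass_ge0// ler_expR x2 CE.
  by move: v2 uvE qi0 i20; lra.
apply: (le_trans (ler_wpM2r (expR_ge0 _) dn)).
rewrite -[leLHS]mulrA -[leRHS]mulrA -!expRD ler_wpM2l ?binom_mass_ge0// ler_expR x2 CE.
by move: u2 uvE qi i20; lra.
Qed.

(** The window has at most [2 K s] steps, each costing a factor
    [1 + O (1 / s ^ 2)]. *)
Lemma rel_mass_window K k l : 0 <= K -> 2 * (K + 1) <= s ->
  (k <= a)%N -> (l <= a)%N -> `|x k| <= K -> `|x l| <= K ->
  rel_mass k <= rel_mass l * expR (2 * K * (2 * (K + 1) ^+ 2 + 1) / s).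
Proof.
move=> K0 sK ka la xk xl; set C := (2 * (K + 1) ^+ 2 + 1) / s ^+ 2.
have C0 : 0 <= C.
  by rewrite divr_ge0 ?sqr_ge0// addr_ge0// mulr_ge0// sqr_ge0.
have chain j d : (j + d <= a)%N -> `|x j| <= K -> `|x (j + d)%N| <= K ->
    rel_mass (j + d) <= rel_mass j * expR (d%:R * C) /\
    rel_mass j <= rel_mass (j + d) * expR (d%:R * C).
  elim: d => [|d IH]; first by rewrite addn0 mul0r expR0 mulr1.
  rewrite addnS => da xj xd.
  have xd' : `|x (j + d)%N| <= K.
    move: xj xd; rewrite !ler_norml => /andP[jl _] /andP[_ du].
    rewrite (le_trans jl) ?bstd_le ?leq_addr//=.
    by apply: le_trans du; rewrite bstd_le.
  have [H1 H2] := IH (ltnW da) xj xd'.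
  have [H3 H4] := rel_mass_step K0 sK da xd'.
  have -> : d.+1%:R * C = d%:R * C + C by rewrite -natr1; ring.
  rewrite expRD; split.
    by rewrite mulrA; apply: (le_trans H3); rewrite ler_wpM2r ?expR_ge0.
  apply: (le_trans H2).
  rewrite [leRHS](_ : _ = rel_mass (j + d).+1 * expR C * expR (d%:R * C)); last by ring.
  by rewrite ler_wpM2r ?expR_ge0.
have dle j d : `|x j| <= K -> `|x (j + d)%N| <= K -> d%:R * C <= 2 * K * (2 * (K + 1) ^+ 2 + 1) / s.
  rewrite !ler_norml => /andP[jl _] /andP[_ du].
  have : d%:R / s <= 2 * K.
    have -> : d%:R / s = x (j + d)%N - x j by rewrite /bstd natrD; ring.
    by move: jl du; lra.
  move=> dK; have -> : d%:R * C = d%:R / s * ((2 * (K + 1) ^+ 2 + 1) / s).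
    by rewrite /C; field; rewrite gt_eqF.
  rewrite -[leRHS]mulrA ler_wpM2r// divr_ge0 ?(ltW s0)//.
  by rewrite addr_ge0// mulr_ge0// sqr_ge0.
have [kl|lk] := leqP k l.
  have E : l = (k + (l - k))%N by rewrite subnKC.
  rewrite E in la xl *; have [_ H] := chain _ _ la xk xl.
  apply: (le_trans H); rewrite ler_wpM2l ?rel_mass_ge0// ler_expR.
  exact: dle xk xl.
have E : k = (l + (k - l))%N by rewrite subnKC// ltnW.
rewrite E in ka xk *; have [H _] := chain _ _ ka xl xk.
apply: (le_trans H); rewrite ler_wpM2l ?rel_mass_ge0// ler_expR.
exact: dle xl xk.
Qed.

(** Over one cell, of length [1 / s], the density varies by a factor
    [exp (O (1 / s))]. *)
Lemma cell_bounds K k : 0 <= K -> 1 <= s -> `|x k| <= K ->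
  peak / s * expR (- (x k ^+ 2 / 2)) * expR (- ((K + 1) / s)) <= cell k <=
  peak / s * expR (- (x k ^+ 2 / 2)) * expR ((K + 1) / s).
Proof.
move=> K0 s1 xK; set c := peak / s * expR _.
have pk0 : 0 <= peak := normal_peak_ge0 _.
have i0 : 0 < s^-1 by rewrite invr_gt0.
have i1 : s^-1 <= 1 by rewrite invf_le1.
have [xl xu] : - K <= x k /\ x k <= K by move: xK; rewrite ler_norml => /andP.
have dx : x k.+1 - x k = s^-1 by rewrite bstdS addrC addKr.
pose lo := peak * expR (- (x k ^+ 2 / 2)) * expR (- ((K + 1) / s)).
pose hi := peak * expR (- (x k ^+ 2 / 2)) * expR ((K + 1) / s).
have := @normal_cdf_diff_bounds R (x k) (x k.+1) lo hi.
rewrite dx -/(cell k).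
have -> : lo * s^-1 = c * expR (- ((K + 1) / s)) by rewrite /lo /c; ring.
have -> : hi * s^-1 = c * expR ((K + 1) / s) by rewrite /hi /c; ring.
apply; first by rewrite bstd_le.
  by rewrite !mulr_ge0 ?expR_ge0.
move=> y /andP[y1 y2]; rewrite normal_pdfE ?oner_eq0// /normal_fun subr0 expr1n.
rewrite mulNr -[1 *+ 2]/(2 : R).
rewrite /lo /hi -[X in X <= _]mulrA -[X in _ <= _ <= X]mulrA -!expRD.
have d0 : 0 <= y - x k by rewrite subr_ge0.
have d1 : y - x k <= s^-1 by rewrite -dx lerD2r.
have yE : y ^+ 2 / 2 = x k ^+ 2 / 2 + (y - x k) * (y + x k) / 2 by field.
have bd : `|(y - x k) * (y + x k) / 2| <= (K + 1) / s.
  rewrite -[X in `|X|]mulrA normrM (ger0_norm d0) [leRHS]mulrC.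
  apply: ler_pM => //; rewrite ler_norml.
  by move: d0 d1 i1 xl xu; lra.
move: bd; rewrite ler_norml => /andP[bd1 bd2].
by rewrite !ler_wpM2l//= ?ler_expR yE; move: bd1 bd2; lra.
Qed.

(** On the window the ratio of binomial to normal mass is almost constant. The
    cross-multiplied form leaves the constant unnamed, so that no evaluation of
    factorials is needed: it will follow from both total masses being [1]. *)
Lemma mass_cell_exchange K k l : 0 <= K -> 2 * (K + 1) <= s ->
  (k <= a)%N -> (l <= a)%N -> `|x k| <= K -> `|x l| <= K ->
  b k * cell l <= b l * cell k *
    expR ((2 * K * (2 * (K + 1) ^+ 2 + 1) + 2 * (K + 1)) / s).
Proof.
move=> K0 sK ka la xk xl.
have s1 : 1 <= s by move: sK K0; lra.
have /andP[_ cl] := cell_bounds K0 s1 xl.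
have /andP[ck _] := cell_bounds K0 s1 xk.
have rm := rel_mass_window K0 sK ka la xk xl.
set e1 := 2 * K * _ / s in rm; pose e2 := (K + 1) / s.
have -> : (2 * K * (2 * (K + 1) ^+ 2 + 1) + 2 * (K + 1)) / s = e1 + e2 + e2.
  by rewrite /e1 /e2; ring.
have bE j : b j = rel_mass j * expR (- (x j ^+ 2 / 2)).
  by rewrite /rel_mass -mulrA -expRD addrN expR0 mulr1.
apply: (le_trans (ler_wpM2l (binom_mass_ge0 k) cl)); rewrite -/e2.
apply: (@le_trans _ _ (rel_mass l * expR e1 * (peak / s * expR (- (x k ^+ 2 / 2)) * expR (- (x l ^+ 2 / 2)) * expR e2))).
  rewrite {1}bE [leLHS](_ : _ = rel_mass k * (peak / s * expR (- (x k ^+ 2 / 2)) * expR (- (x l ^+ 2 / 2)) * expR e2)); last by ring.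
  by rewrite ler_wpM2r// !mulr_ge0 ?expR_ge0 ?normal_peak_ge0// invr_ge0 ltW.
rewrite [b l]bE.
apply: (@le_trans _ _ (rel_mass l * expR (- (x l ^+ 2 / 2)) * (peak / s * expR (- (x k ^+ 2 / 2)) * expR (- e2)) * expR (e1 + e2 + e2))).
  have E : expR (- e2) * expR (e1 + e2 + e2) = expR e1 * expR e2.
    by rewrite -!expRD; congr expR; ring.
  rewrite -[leRHS]mulrA -[X in _ <= _ * X]mulrA E.
  by rewrite le_eqVlt; apply/orP; left; apply/eqP; ring.
rewrite ler_wpM2r ?expR_ge0// ler_wpM2l// mulr_ge0 ?rel_mass_ge0 ?expR_ge0//.
Qed.

(** The normal masses of the cells that start between [al] and [be] telescope
    once the cell boundaries are clamped to that interval, the right end of which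
    is extended by one cell. *)
Lemma sum_cell_le al be : al <= be ->
  \sum_(k < a.+1 | al <= x k <= be) cell k <= Phi (be + s^-1) - Phi al.
Proof.
move=> albe; have i0 : 0 < s^-1 by rewrite invr_gt0.
pose c y := Num.max al (Num.min y (be + s^-1)).
have cmono u v : u <= v -> c u <= c v.
  by move=> uv; rewrite /c ge_max le_max lexx /= le_max le_min !ge_min uv lexx !orbT.
have cal y : al <= c y by rewrite /c le_max lexx.
have cbe y : c y <= be + s^-1.
  by rewrite /c ge_max ge_min lexx orbT andbT (le_trans albe)// lerDl ltW.
apply: (@le_trans _ _ (\sum_(k < a.+1) (Phi (c (x k.+1)) - Phi (c (x k))))).
  rewrite big_mkcond; apply: ler_sum => k _; case: ifP => [/andP[h1 h2]|_].
    have cid y : al <= y -> y <= be + s^-1 -> c y = y.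
      by move=> ay yb; rewrite /c (min_idPl yb) (max_idPr ay).
    rewrite /cell !cid//.
    - by rewrite (le_trans h2)// lerDl ltW.
    - by rewrite (le_trans h1)// bstd_le.
    - by rewrite bstdS lerD2r.
  by rewrite subr_ge0 normal_cdf_mono// cmono// bstd_le.
rewrite -(big_mkord xpredT (fun k => Phi (c (x k.+1)) - Phi (c (x k)))) telescope_sumr//.
by rewrite lerB// normal_cdf_mono.
Qed.

(** Here it is the left end of the interval that is moved by one cell, so that
    cells starting before [al] contribute nothing. *)
Lemma sum_cell_ge al be : x 0 <= al + s^-1 -> be <= x a.+1 ->
  al + s^-1 <= be ->
  Phi be - Phi (al + s^-1) <= \sum_(k < a.+1 | al <= x k <= be) cell k.
Proof.
move=> x0 xa albe; have i0 : 0 < s^-1 by rewrite invr_gt0.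
pose c y := Num.max (al + s^-1) (Num.min y be).
have cmono u v : u <= v -> c u <= c v.
  by move=> uv; rewrite /c ge_max le_max lexx /= le_max le_min !ge_min uv lexx !orbT.
have c0 : c (x 0) = al + s^-1.
  by rewrite /c (max_idPl _)// ge_min x0.
have ca : c (x a.+1) = be by rewrite /c (min_idPr xa) (max_idPr _).
rewrite -[X in Phi X - _ <= _]ca -[X in _ - Phi X <= _]c0.
rewrite -(telescope_sumr (fun k => Phi (c (x k))))// big_mkord [leRHS]big_mkcond.
apply: ler_sum => k _; case: ifPn => [/andP[h1 h2]|].
  rewrite /cell.
  have c1 : c (x k.+1) <= x k.+1.
    by rewrite /c ge_max bstdS lerD2r h1 ge_min lexx.
  have c2 : x k <= c (x k).
    by rewrite /c le_max le_min lexx h2 orbT.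
  by rewrite lerB// normal_cdf_mono.
rewrite negb_and -!ltNge => /orP[lt|lt].
  have cl y : y <= al + s^-1 -> c y = al + s^-1.
    by move=> yl; rewrite /c (max_idPl _)// ge_min yl.
  rewrite !cl ?subrr//; first by rewrite (le_trans (ltW lt))// lerDl ltW.
  by rewrite bstdS lerD2r ltW.
have cl y : be <= y -> c y = be.
  by move=> yl; rewrite /c (min_idPr yl) (max_idPr _).
rewrite !cl ?subrr//; first exact: ltW.
by rewrite (le_trans (ltW lt))// bstd_le.
Qed.

Lemma bstd_first K : K <= s -> x 0 <= - K.
Proof.
move=> Ks; rewrite /bstd sub0r mulNr lerN2 ler_pdivlMr//.
apply: (@le_trans _ _ (s ^+ 2)); first by rewrite expr2 ler_wpM2r// ltW.
by rewrite sE ler_piMr ?mulr_ge0 ?(ltW p0)//; move: p0; lra.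
Qed.

Lemma bstd_last K : K <= s -> K <= x a.+1.
Proof.
move=> Ks; rewrite /bstd ler_pdivlMr//.
apply: (@le_trans _ _ (s ^+ 2)); first by rewrite expr2 ler_wpM2r// ltW.
apply: (@le_trans _ _ (a%:R * (1 - p))); last by rewrite -natr1; lra.
by rewrite sE mulrAC ler_piMr ?mulr_ge0 ?(ltW q0)//; move: q0; lra.
Qed.

Lemma sum_cell_window K t : 1 <= s -> K <= s -> `|t| <= K - 1 ->
  Phi t - (1 - (Phi (K - 1) - Phi (- (K - 1)))) <= \sum_(k < a.+1 | - K <= x k <= t) cell k <= Phi t + peak / s.
Proof.
move=> s1 Ks tK; set tail := 1 - _; have i0 : 0 < s^-1 by rewrite invr_gt0.
have i1 : s^-1 <= 1 by rewrite invf_le1.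
have [tK1 tK2] : - (K - 1) <= t /\ t <= K - 1 by move: tK; rewrite ler_norml => /andP.
apply/andP; split.
  have x0 := bstd_first Ks; have xa := bstd_last Ks.
  apply: le_trans (sum_cell_ge _ _ _); [|lra|lra|lra].
  have : Phi (- K + s^-1) <= Phi (- (K - 1)) by apply: normal_cdf_mono; lra.
  by have := normal_cdf_le1 (K - 1); rewrite /tail; lra.
apply: (le_trans (sum_cell_le _)); first lra.
have up : Phi (t + s^-1) - Phi t <= peak * (t + s^-1 - t).
  by apply: normal_cdf_lipschitz; rewrite lerDl ltW.
move: up; rewrite [t + s^-1 - t]addrC addKr.
by have := normal_cdf_ge0 (- K); lra.
Qed.

Lemma sum_exchange (I W : pred nat) (F G : nat -> R) (c : R) :
  (forall k l : 'I_a.+1, I k -> W l -> F k * G l <= F l * G k * c) ->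
  (\sum_(k < a.+1 | I k) F k) * (\sum_(l < a.+1 | W l) G l) <=
  (\sum_(l < a.+1 | W l) F l) * (\sum_(k < a.+1 | I k) G k) * c.
Proof.
move=> H; rewrite !big_distrlr /= [in leRHS]exchange_big /= mulr_suml.
apply: ler_sum => k Ik; rewrite mulr_suml; apply: ler_sum => l Wl.
exact: H.
Qed.

(** On the window [|x k| <= K] the binomial and the normal masses are
    proportional up to the factor of [mass_cell_exchange]; outside it
    Chebyshev's inequality and the tails of the normal law take over. *)
Lemma binom_cdf_bounds K t : 0 < K -> 2 * (K + 1) <= s -> `|t| <= K - 1 ->
  let tail := 1 - (Phi (K - 1) - Phi (- (K - 1))) in
  let E := expR ((2 * K * (2 * (K + 1) ^+ 2 + 1) + 2 * (K + 1)) / s) in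
  let P := \sum_(k < a.+1 | x k <= t) b k in
  (P - (K ^+ 2)^-1) * (1 - tail) <= (Phi t + peak / s) * E /\
  (1 - (K ^+ 2)^-1) * (Phi t - tail) <= P * E.
Proof.
move=> K0 sK tK tail E P.
have s1 : 1 <= s by lra.
have Ks : K <= s by lra.
pose I (k : nat) := - K <= x k <= t.
pose W (k : nat) := `|x k| <= K.
have [tK1 tK2] : - (K - 1) <= t /\ t <= K - 1 by move: tK; rewrite ler_norml => /andP.
have IW k : I k -> W k.
  by move=> /andP[h1 h2]; rewrite /W ler_norml h1 (le_trans h2)//; lra.
have WE (k : nat) : W k = (- K <= x k <= K) by rewrite /W ler_norml.
pose PI := \sum_(k < a.+1 | I k) b k; pose PW := \sum_(k < a.+1 | W k) b k.
pose NI := \sum_(k < a.+1 | I k) cell k; pose NW := \sum_(k < a.+1 | W k) cell k.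
have /andP[NI_dn NI_up] : Phi t - tail <= NI <= Phi t + peak / s.
  exact: sum_cell_window.
have NI0 : 0 <= NI by apply: sumr_ge0 => k _; exact: cell_ge0.
have PI0 : 0 <= PI by apply: sumr_ge0 => k _; exact: binom_mass_ge0.
have NW_dn : 1 - tail <= NW.
  rewrite /NW (eq_bigl (fun k : 'I_a.+1 => - K <= x k <= K)) => [|k]; last exact: WE.
  have x0 := bstd_first Ks; have xa := bstd_last Ks.
  have i0 : 0 < s^-1 by rewrite invr_gt0.
  have i1 : s^-1 <= 1 by rewrite invf_le1.
  apply: le_trans (sum_cell_ge _ _ _); [|lra|lra|lra].
  have : Phi (- K + s^-1) <= Phi (- (K - 1)) by apply: normal_cdf_mono; lra.
  have : Phi (K - 1) <= Phi K by apply: normal_cdf_mono; lra.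
  by rewrite /tail; lra.
have NW_up : NW <= 1.
  rewrite /NW (eq_bigl (fun k : 'I_a.+1 => - K <= x k <= K)) => [|k]; last exact: WE.
  apply: (le_trans (sum_cell_le _)); first lra.
  by have := normal_cdf_ge0 (- K); have := normal_cdf_le1 (K + s^-1); lra.
have cheb : \sum_(k < a.+1 | K < `|x k|) b k <= (K ^+ 2)^-1 by exact: binom_tail.
have cheb0 : 0 <= \sum_(k < a.+1 | K < `|x k|) b k.
  by apply: sumr_ge0 => k _; exact: binom_mass_ge0.
have PWE : PW + \sum_(k < a.+1 | K < `|x k|) b k = 1.
  rewrite -binom_total [RHS](bigID (fun k : 'I_a.+1 => W k)) /=.
  by congr (_ + _); apply: eq_bigl => k; rewrite /W -ltNge.
have exch (k l : 'I_a.+1) : W k -> W l -> b k * cell l <= b l * cell k * E.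
  have ka : (k <= a)%N by rewrite -ltnS.
  have la : (l <= a)%N by rewrite -ltnS.
  by move=> wk wl; exact: (mass_cell_exchange (ltW K0) sK ka la wk wl).
have cross1 : PI * NW <= PW * NI * E.
  by apply: sum_exchange => k l /IW Ik Wl; exact: exch.
have cross2 : PW * NI <= PI * NW * E.
  by apply: sum_exchange => k l Wk /IW Il; exact: exch.
have E0 : 0 <= E by exact: expR_ge0.
have PIP : PI <= P.
  rewrite /PI /P big_mkcond [leRHS]big_mkcond; apply: ler_sum => k _ /=.
  by rewrite /I; case: (- K <= x k) => //=; case: ifP => // _; exact: binom_mass_ge0.
have PPI : P <= PI + (K ^+ 2)^-1.
  apply: le_trans (lerD (lexx PI) cheb).
  rewrite /PI /P big_mkcond [X in _ <= X + _]big_mkcond [X in _ <= _ + X]big_mkcond.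
  rewrite -big_split; apply: ler_sum => k _ /=; rewrite /I.
  have b0 := binom_mass_ge0 k.
  case: (leP (x k) t) => [xt|_]; last by rewrite andbF add0r; case: ifP.
  rewrite andbT; case: (leP (- K) (x k)) => [_|lt]; first by rewrite lerDl; case: ifP.
  by rewrite add0r ifT// ltr_normr [X in _ || X]ltrNr lt orbT.
split.
  have tail1 : 0 <= 1 - tail.
    by rewrite /tail opprB addrC subrK subr_ge0 normal_cdf_mono//; lra.
  apply: (@le_trans _ _ (PI * NW)).
    apply: (@le_trans _ _ (PI * (1 - tail))); last by rewrite ler_wpM2l.
    by rewrite ler_wpM2r//; lra.
  apply: (le_trans cross1); rewrite ler_wpM2r//.
  by apply: le_trans NI_up; rewrite ler_piMl//; lra.
apply: (@le_trans _ _ (PW * NI)).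
  have k1 : 0 <= 1 - (K ^+ 2)^-1.
    rewrite subr_ge0 invf_le1 ?exprn_gt0// exprn_ege1//.
    by have := normr_ge0 t; lra.
  apply: (@le_trans _ _ ((1 - (K ^+ 2)^-1) * NI)); first by rewrite ler_wpM2l.
  by rewrite ler_wpM2r//; lra.
apply: (le_trans cross2); rewrite ler_wpM2r//.
by apply: le_trans PIP; rewrite ler_piMr.
Qed.

End DeMoivreLaplace.

(** The de Moivre-Laplace theorem. Uniformity in [a] and [p] is what allows both
    to vary with [n]; only the variance [s ^ 2] matters. *)
Theorem de_moivre_laplace (R : realType) (t eps : R) : 0 < eps ->
  exists2 s0 : R, 0 < s0 & forall (a : nat) (p s : R), 0 < p < 1 -> s0 <= s ->
    s ^+ 2 = a%:R * p * (1 - p) ->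
    `|\sum_(k < a.+1 | bstd a p s k <= t) binom_mass p a k - normal_cdf t| <= eps.
Proof.
move=> eps0; pose eta : R := Num.min (eps / 10) (1 / 10).
have eta0 : 0 < eta by rewrite lt_min !divr_gt0.
have eta1 : eta <= 1 / 10 by rewrite ge_min lexx orbT.
have eta_eps : 10 * eta <= eps.
  have : eta <= eps / 10 by rewrite ge_min lexx.
  lra.
have [K1 K10 HK1] := normal_cdf_tails eta0.
pose K := K1 + `|t| + eta^-1 + 1.
have tn := normr_ge0 t.
have ie0 : 0 < eta^-1 by rewrite invr_gt0.
have K0 : 0 < K by rewrite /K; lra.
have KK1 : K1 <= K - 1 by rewrite /K; lra.
have Kt : `|t| <= K - 1 by rewrite /K; lra.
have Keta : (K ^+ 2)^-1 <= eta.
  rewrite -[leRHS]invrK lef_pV2 ?posrE ?exprn_gt0// expr2.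
  apply: (@le_trans _ _ (eta^-1 * 1)); first by rewrite mulr1.
  by apply: ler_pM => //; rewrite /K; lra.
pose C := 2 * K * (2 * (K + 1) ^+ 2 + 1) + 2 * (K + 1).
have C0 : 0 <= C.
  have q0 : 0 <= (K + 1) ^+ 2 by exact: sqr_ge0.
  have : 0 <= 2 * K * (2 * (K + 1) ^+ 2 + 1) by rewrite mulr_ge0//; lra.
  by rewrite /C; lra.
have pk0 : 0 <= normal_peak 1 :> R by exact: normal_peak_ge0.
(* The three terms make the window wide enough, the factor of
   [mass_cell_exchange] close to [1], and the mass of a cell small. *)
exists (2 * (K + 1) + 2 * C / eta + normal_peak 1 / eta).
  have : 0 <= 2 * C / eta by rewrite divr_ge0 ?mulr_ge0// ltW.
  have : 0 <= normal_peak 1 / eta by rewrite divr_ge0// ltW.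
  lra.
move=> a p s p01 ss sE.
have Ce0 : 0 <= 2 * C / eta by rewrite divr_ge0 ?mulr_ge0// ltW.
have pe0 : 0 <= normal_peak 1 / eta by rewrite divr_ge0// ltW.
have sK : 2 * (K + 1) <= s by lra.
have s1 : 1 <= s by lra.
have s0 : 0 < s by lra.
have is0 : 0 < s^-1 by rewrite invr_gt0.
have is1 : s^-1 <= 1 by rewrite invf_le1.
have sC : C / s <= eta / 2.
  rewrite ler_pdivrMr//; have : 2 * C / eta <= s by lra.
  by rewrite ler_pdivrMr//; lra.
have sP : normal_peak 1 / s <= eta.
  rewrite ler_pdivrMr//; have : normal_peak 1 / eta <= s by lra.
  by rewrite ler_pdivrMr//; lra.
have [p0 q0] : 0 < p /\ 0 < 1 - p by case/andP: p01; split; lra.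
have e1 : expR (C / s) <= 1 + eta.
  apply: (@le_trans _ _ (expR (eta / 2))); first by rewrite ler_expR.
  rewrite -[leLHS]invrK -expRN -[leRHS]invrK lef_pV2 ?posrE ?invr_gt0 ?expR_gt0//; last lra.
  apply: le_trans (expR_ge1Dx _); rewrite -[leLHS]mul1r ler_pdivrMr; last lra.
  by clear -eta0 eta1; nra.
have [] := binom_cdf_bounds p01 s0 sE K0 sK Kt.
set P := \sum_(_ < _ | _) _; rewrite -/C.
set tail := 1 - (normal_cdf (K - 1) - normal_cdf (- (K - 1))).
set E := expR _ in e1 *.
have tails : tail <= eta by have := HK1 _ KK1; rewrite /tail; lra.
have tail0 : 0 <= tail.
  have := @normal_cdf_ge0 R (- (K - 1)); have := @normal_cdf_le1 R (K - 1).
  by rewrite /tail; lra.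
have P0 : 0 <= P.
  by apply: sumr_ge0 => k _; exact: binom_mass_ge0.
have := @normal_cdf_ge0 R t; have := @normal_cdf_le1 R t; move: (normal_cdf t) => Ph Ph1 Ph0.
have P1 : P <= 1.
  rewrite -(binom_mean1 p a) /binom_mean /P big_mkcond; apply: ler_sum => k _.
  by rewrite mulr1; case: ifP => // _; exact: binom_mass_ge0.
have E0 : 0 <= E by exact: expR_ge0.
have E1 : 1 <= E by rewrite /E -expR0 ler_expR divr_ge0// ltW.
move: Keta sP; set k2 := (K ^+ 2)^-1; set pk := normal_peak 1 / s => Keta sP up dn.
have k20 : 0 <= k2 by rewrite invr_ge0 exprn_ge0// ltW.
have pk0' : 0 <= pk by rewrite divr_ge0// ltW.
clear -eta0 eta1 eta_eps P0 P1 Ph1 Ph0 E0 E1 e1 tails tail0 k20 Keta pk0' sP up dn.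
have up1 : P - eta - eta <= (Ph + eta) * (1 + eta).
  apply: (@le_trans _ _ ((P - k2) * (1 - tail))).
    have : P * tail <= 1 * eta by apply: ler_pM.
    have : 0 <= k2 * tail by exact: mulr_ge0.
    lra.
  by apply: (le_trans up); apply: ler_pM => //; lra.
have dn1 : Ph - eta - eta <= P * (1 + eta).
  apply: (@le_trans _ _ ((1 - k2) * (Ph - tail))).
    have : k2 * Ph <= eta * 1 by apply: ler_pM.
    have : 0 <= k2 * tail by exact: mulr_ge0.
    lra.
  by apply: (le_trans dn); rewrite ler_wpM2l.
have eP : P * eta <= eta by rewrite ler_piMl// ltW.
have ePh : Ph * eta <= eta by rewrite ler_piMl// ltW.
have ee : eta * eta <= eta by rewrite ler_piMl; lra.
rewrite ler_norml; apply/andP; split; lra.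
Qed.

(** * The expected number of copies as a function of the number of arcs *)

(** The logarithm of the expected number of copies, as a function of the
    standardised number [x] of arcs: its linear part carries the limit law and
    its quadratic part is the drift [beta ^ 2 / 2]. The induction on [k] adds the
    logarithm of one factor [(1 + u) / (1 + v)] at a time. *)
Lemma ln_incl_prob (R : realType) (a m h : nat) (p x d K : R) :
  let T := a%:R * p in
  0 < p < 1 -> 0 < T -> 0 <= d -> d ^+ 2 = (1 - p) / T ->
  m%:R = T * (1 + x * d) -> `|x| <= K -> 4 * (K * d) <= 1 -> 4 * h%:R <= T ->
  forall k, (k <= h)%N ->
  [/\ (k <= m)%N, 0 < incl_prob R a m k &
    `|ln (incl_prob R a m k / p ^+ k) - (k%:R * (x * d) - k%:R * (k%:R - 1) / 2 * d ^+ 2)|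
    <= k%:R * (4 * K ^+ 2 * d ^+ 2 + 6 * (h%:R / T) ^+ 2)].
Proof.
move=> T /andP[p0 p1] T0 d0 d2 mE xK Kd hT.
have aT : T <= a%:R by rewrite /T ler_piMr// ltW.
have a0 : 0 < a%:R :> R by apply: lt_le_trans aT.
have xd : `|x * d| <= K * d by rewrite normrM (ger0_norm d0) ler_wpM2r.
have [xd1 xd2] : - (K * d) <= x * d /\ x * d <= K * d by move: xd; rewrite ler_norml => /andP.
have m3 : 3 / 4 * T <= m%:R :> R.
  rewrite mE mulrC ler_wpM2l ?(ltW T0)//; lra.
set c := 4 * K ^+ 2 * d ^+ 2 + 6 * (h%:R / T) ^+ 2.
elim=> [_|k IH kh].
  rewrite /incl_prob !ffactn0 expr0 !divr1 ln1 !mul0r subrr subr0 normr0.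
  by split => //; rewrite ltr01.
have kR : k%:R + 1 <= h%:R :> R by rewrite natr1 ler_nat.
have k0 : 0 <= k%:R :> R by exact: ler0n.
have km : (k.+1 <= m)%N by rewrite -(ler_nat R) -natr1; lra.
have ka : (k.+1 <= a)%N by rewrite -(ler_nat R) -natr1; lra.
have [_ Q0 IHk] := IH (ltnW kh).
pose u : R := x * d - k%:R / T; pose v : R := - (k%:R / a%:R).
have kT : k%:R / T <= h%:R / T by rewrite ler_wpM2r ?invr_ge0 ?(ltW T0)//; lra.
have kT0 : 0 <= k%:R / T by rewrite divr_ge0// ltW.
have hT4 : h%:R / T <= 1 / 4 by rewrite ler_pdivrMr//; lra.
have ka0 : 0 <= k%:R / a%:R :> R by rewrite divr_ge0// ltW.
have kaT : k%:R / a%:R <= k%:R / T by rewrite ler_wpM2l// lef_pV2 ?posrE.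
have uh : `|u| <= 2^-1 by rewrite ler_norml /u; clear -xd1 xd2 kT kT0 hT4 Kd; apply/andP; split; lra.
have vh : `|v| <= 2^-1 by rewrite ler_norml /v; clear -ka0 kaT kT hT4; apply/andP; split; lra.
have [u1 u2] : u - 2 * u ^+ 2 <= ln (1 + u) /\ ln (1 + u) <= u.
  by have := ln1D_bounds uh => /andP.
have [v1 v2] : v - 2 * v ^+ 2 <= ln (1 + v) /\ ln (1 + v) <= v.
  by have := ln1D_bounds vh => /andP.
have u0 : 0 < 1 + u by move: uh; rewrite ler_norml => /andP[? _]; lra.
have v0 : 0 < 1 + v by move: vh; rewrite ler_norml => /andP[? _]; lra.
have sq (y z : R) : 0 <= z -> `|y| <= z -> y ^+ 2 <= z ^+ 2.
  by move=> z0 yz; rewrite -[leLHS]real_normK ?num_real// ler_sqr ?nnegrE.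
have Kd0 : 0 <= K * d by rewrite mulr_ge0// (le_trans _ xK).
have uu : u ^+ 2 <= 2 * (K ^+ 2 * d ^+ 2) + 2 * (h%:R / T) ^+ 2.
  have H1 := sq _ _ Kd0 xd; rewrite exprMn [leRHS]exprMn in H1.
  have H2 : (k%:R / T) ^+ 2 <= (h%:R / T) ^+ 2 by apply: sq; rewrite ?ger0_norm//; clear -kT kT0; lra.
  have H3 : 0 <= (x * d + k%:R / T) ^+ 2 by exact: sqr_ge0.
  have -> : u ^+ 2 = 2 * (x ^+ 2 * d ^+ 2) + 2 * (k%:R / T) ^+ 2 - (x * d + k%:R / T) ^+ 2.
    by rewrite /u; ring.
  by clear -H1 H2 H3; lra.
have vv : v ^+ 2 <= (h%:R / T) ^+ 2.
  by apply: sq; rewrite /v ?normrN ?ger0_norm//; clear -ka0 kaT kT; lra.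
have QE : incl_prob R a m k.+1 / p ^+ k.+1 =
    incl_prob R a m k / p ^+ k * ((1 + u) / (1 + v)).
  rewrite incl_probS exprS !natrB ?(ltnW km) ?(ltnW ka)// mE.
  have -> : (a%:R - k%:R : R) = a%:R * (1 + v) by rewrite /v; field; rewrite gt_eqF.
  have -> : T * (1 + x * d) - k%:R = a%:R * p * (1 + u).
    by rewrite /u -/T; field; rewrite gt_eqF.
  by field; rewrite !gt_eqF// exprn_gt0.
split => //.
  by rewrite incl_probS mulr_gt0// divr_gt0// ltr0n subn_gt0.
have P0 : 0 < incl_prob R a m k / p ^+ k by rewrite divr_gt0// exprn_gt0.
have L1 : ln ((1 + u) / (1 + v)) = ln (1 + u) - ln (1 + v) by rewrite ln_div ?posrE.
have uv0 : 0 < (1 + u) / (1 + v) by rewrite divr_gt0.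
have L2 : ln (incl_prob R a m k / p ^+ k * ((1 + u) / (1 + v))) =
   ln (incl_prob R a m k / p ^+ k) + ln ((1 + u) / (1 + v)).
  by rewrite [LHS]lnM ?posrE.
rewrite QE L2 L1.
have uv : u - v = x * d - k%:R * d ^+ 2.
  rewrite d2 /u /v /T; field; rewrite !gt_eqF//.
have E1 : k.+1%:R * (x * d) - k.+1%:R * (k.+1%:R - 1) / 2 * d ^+ 2 =
   (k%:R * (x * d) - k%:R * (k%:R - 1) / 2 * d ^+ 2) + (u - v).
  by rewrite uv -natr1; field.
have cE : c = 4 * (K ^+ 2 * d ^+ 2) + 6 * (h%:R / T) ^+ 2 by rewrite /c mulrA.
rewrite E1 -[k.+1%:R * c](_ : k%:R * c + c = _); last by rewrite -natr1; ring.
move: IHk; set A := ln _; set B := _ - _ / 2 * _ => IHk.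
rewrite [X in `|X|](_ : _ = (A - B) + (ln (1 + u) - ln (1 + v) - (u - v))); last by ring.
apply: (le_trans (ler_normD _ _)); apply: lerD => //.
clear -u1 u2 v1 v2 uu vv cE.
have u20 := sqr_ge0 u; have v20 := sqr_ge0 v.
rewrite ler_norml; apply/andP; split; lra.
Qed.

Section Dnp.
Variables (R : realType) (n : nat) (p : R).
Local Notation a := (2 * nbpairs n)%N.
Hypothesis p01 : 0 < p < 1.

Lemma DnpE (G : digraph n) : Dnp p G = p ^+ #|G| * (1 - p) ^+ (a - #|G|).
Proof.
rewrite /Dnp (bigID [in G]) /= (eq_bigr (fun=> p)) => [|e ->//].
rewrite [X in _ * X](eq_bigr (fun=> 1 - p)) => [|e /negbTE ->//].
rewrite !prodr_const; congr (_ * _ ^+ _).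
by rewrite -card_arc -(cardC [in G]) addKn.
Qed.

Lemma Dnp_ge0 (G : digraph n) : 0 <= Dnp p G.
Proof.
case/andP: p01 => p0 p1.
by rewrite DnpE mulr_ge0 ?exprn_ge0 ?subr_ge0// ltW.
Qed.

Lemma card_digraph_le (G : digraph n) : (#|G| <= a)%N.
Proof. by rewrite -card_arc max_card. Qed.

(** The number of arcs is binomial, and conditionally on it the digraph is
    uniform. *)
Lemma Pr_Dnp (A : pred (digraph n)) :
  Pr (@Dnp R n p) A = \sum_(k < a.+1) binom_mass p a k * Pr (@Dnm R n k) A.
Proof.
rewrite /Pr; under [RHS]eq_bigr do rewrite mulr_sumr.
rewrite exchange_big /=; apply: eq_bigr => G _.
have Ga : (#|G| < a.+1)%N by rewrite ltnS card_digraph_le.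
rewrite (bigD1 (Ordinal Ga)) //= big1 ?addr0 => [|k kG].
  rewrite /Dnm eqxx card_draws card_arc DnpE /binom_mass.
  have : 'C(a, #|G|)%:R != 0 :> R by rewrite pnatr_eq0 -lt0n bin_gt0 -ltnS.
  by move=> C0; rewrite -(mulrA 'C(_, _)%:R) mulrAC divff// mul1r.
rewrite /Dnm; case: eqP => [E|_]; last by rewrite mulr0.
by move: kG; rewrite -val_eqE /= E eqxx.
Qed.

Lemma Pr_Dnp_card (P : pred nat) :
  Pr (@Dnp R n p) (fun G => P #|G|) = \sum_(k < a.+1 | P k) binom_mass p a k.
Proof.
rewrite Pr_Dnp [RHS]big_mkcond; apply: eq_bigr => k _.
have -> : Pr (@Dnm R n k) (fun G => P #|G|) = if P k then Pr (@Dnm R n k) xpredT else 0.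
  rewrite /Pr big_mkcond [in RHS]big_mkcond /=; case: ifP => Pk.
    by apply: eq_bigr => G _; rewrite /Dnm; case: eqP => [->|_]; rewrite ?Pk//; case: ifP.
  by apply: big1 => G _; rewrite /Dnm; case: eqP => [->|_]; rewrite ?Pk//; case: ifP.
by case: ifP; rewrite ?mulr0// Dnm_total ?mulr1// -ltnS.
Qed.

End Dnp.

(** * From concentration to the law of the logarithm *)

Lemma Pr_sandwich (R : realType) (T : finType) (mu : T -> R) (Y : T -> \bar R)
    (x : T -> R) (B : pred T) (t del : R) :
  (forall w, 0 <= mu w) ->
  (forall w, ~~ B w -> exists2 r : R, Y w = r%:E & `|r - x w| <= del) ->
  Pr mu (fun w => x w <= t - del) - Pr mu B <= Pr mu (fun w => (Y w <= t%:E)%E)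
    <= Pr mu (fun w => x w <= t + del) + Pr mu B.
Proof.
move=> mu0 H; rewrite lerBlDr; apply/andP; split.
  apply: le_trans (Pr_union mu0 _ _); apply: le_Pr => // w xw.
  have [|/H[r Yr rx]] := boolP (B w); first by rewrite orbT.
  by move: rx; rewrite Yr lee_fin ler_norml orbF => /andP[_ ?]; lra.
apply: le_trans (Pr_union mu0 _ _); apply: le_Pr => // w Yw.
have [|/H[r Yr rx]] := boolP (B w); first by rewrite orbT.
by move: Yw rx; rewrite Yr lee_fin ler_norml orbF => ? /andP[? _]; lra.
Qed.

Section LogCount.
Variables (R : realType) (n h : nat) (S : {set digraph n}) (p : R).
Local Notation a := (2 * nbpairs n)%N.
Hypothesis hS : forall H, H \in S -> #|H| = h.
Hypothesis p01 : 0 < p < 1.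
Let T : R := a%:R * p.
Variable d : R.
Hypotheses (d0 : 0 < d) (dE : d ^+ 2 = (1 - p) / T) (T0 : 0 < T).
Let beta : R := h%:R * d.
Let s : R := T * d.
Implicit Types (K e : R) (G : digraph n).

Definition rel_dev (m : nat) G : R :=
  `|(nbcopies S G)%:R / Ex (@Dnm R n m) (fun G' => (nbcopies S G')%:R) - 1|.

(** Split [ln X] into [ln (X / E X)], which concentration makes [O (e)], and
    [ln (E X)], given by [ln_incl_prob]; the expectation is the one for the actual
    number of arcs. *)
Lemma log_count_close K e G :
  S != finset.set0 -> `|bstd a p s #|G| | <= K -> 4 * (K * d) <= 1 ->
  4 * h%:R <= T -> 0 < beta -> e <= 4^-1 -> rel_dev #|G| G <= e ->
  exists2 r : R,
    (lne (expR (beta ^+ 2 / 2) * (nbcopies S G)%:R / (#|S|%:R * p ^+ h))%:E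
      * beta^-1%:E)%E = r%:E &
    `|r - bstd a p s #|G| | <=
      (2 * e + (h%:R * (4 * K ^+ 2 * d ^+ 2 + 6 * (h%:R / T) ^+ 2) + h%:R * d ^+ 2 / 2)) / beta.
Proof.
move=> S0; set x := bstd _ _ _ _ => xK Kd hT b0 e4 dev.
have [p0 p1] := andP p01.
have s0 : 0 < s by rewrite mulr_gt0.
have mE : #|G|%:R = T * (1 + x * d).
  by rewrite /x /bstd -/T /s; field; rewrite !gt_eqF.
have [hm Q0 HQ] := ln_incl_prob p01 T0 (ltW d0) dE mE xK Kd hT (leqnn h).
move: dev; rewrite /rel_dev (Ex_nbcopies R (card_digraph_le G) hS).
set Q := incl_prob R a #|G| h in Q0 HQ *; set X : R := (nbcopies S G)%:R => dev.
have S1 : 0 < #|S|%:R :> R by rewrite ltr0n card_gt0.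
have ph : 0 < p ^+ h by rewrite exprn_gt0.
set y := X / (#|S|%:R * Q) - 1 in dev.
have [y1 y2] : - e <= y /\ y <= e by move: dev; rewrite ler_norml => /andP.
have y0 : 0 < 1 + y by lra.
have XE : expR (beta ^+ 2 / 2) * X / (#|S|%:R * p ^+ h) =
    expR (beta ^+ 2 / 2) * ((1 + y) * (Q / p ^+ h)).
  by rewrite /y; field; rewrite !gt_eqF.
have Qp : 0 < Q / p ^+ h by rewrite divr_gt0.
have yQ : 0 < (1 + y) * (Q / p ^+ h) by rewrite mulr_gt0.
have lnE : ln (expR (beta ^+ 2 / 2) * ((1 + y) * (Q / p ^+ h))) =
    beta ^+ 2 / 2 + (ln (1 + y) + ln (Q / p ^+ h)).
  by rewrite lnM ?posrE ?expR_gt0// expRK [X in _ + X]lnM ?posrE.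
have pos : 0 < expR (beta ^+ 2 / 2) * ((1 + y) * (Q / p ^+ h)).
  by rewrite mulr_gt0 ?expR_gt0.
rewrite XE (lne_EFin pos) lnE -EFinM.
eexists; first by reflexivity.
have [l1 l2] : y - 2 * y ^+ 2 <= ln (1 + y) /\ ln (1 + y) <= y.
  by apply/andP; apply: ln1D_bounds; apply: (le_trans dev); lra.
have e0 : 0 <= e by exact: le_trans (normr_ge0 y) dev.
have yy : y ^+ 2 <= e / 4.
  rewrite -[leLHS]real_normK ?num_real// expr2 [leRHS]mulrC.
  apply: (@le_trans _ _ (e * e)); first by apply: ler_pM.
  by rewrite ler_wpM2r//; lra.
rewrite -[x in _ - x](mulfK (lt0r_neq0 b0)) -mulrBl normrM normfV (gtr0_norm b0).
rewrite ler_wpM2r ?invr_ge0 ?(ltW b0)//.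
have bx : x * beta = h%:R * (x * d) by rewrite /beta; ring.
have bb : h%:R * (h%:R - 1) / 2 * d ^+ 2 = beta ^+ 2 / 2 - h%:R * d ^+ 2 / 2.
  by rewrite /beta; field.
have hd : 0 <= h%:R * d ^+ 2 / 2 by rewrite divr_ge0// mulr_ge0// sqr_ge0.
move: HQ; rewrite bb; set c := h%:R * (4 * _ * _ + _); rewrite !ler_norml => /andP[q1 q2].
rewrite bx; apply/andP; split; lra.
Qed.

(** Chebyshev's inequality bounds the probability that the number of arcs leaves
    the window; inside it, condition on that number. *)
Lemma Pr_bad K e z : 0 < K -> 0 <= z ->
  (forall k, (k <= a)%N -> `|bstd a p s k| <= K ->
     Pr (@Dnm R n k) (fun G => e < rel_dev k G) <= z) ->
  Pr (@Dnp R n p) (fun G => (K < `|bstd a p s #|G| |) || (e < rel_dev #|G| G))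
    <= (K ^+ 2)^-1 + z.
Proof.
move=> K0 z0 H; have s0 : 0 < s by rewrite mulr_gt0.
have sE : s ^+ 2 = a%:R * p * (1 - p).
  by rewrite /s exprMn dE -/T; field; rewrite gt_eqF.
have b0 k : 0 <= binom_mass p a k by exact: binom_mass_ge0.
rewrite Pr_Dnp; apply: le_trans (lerD (binom_tail p01 s0 sE K0) (lexx _)).
rewrite -[z]mul1r -(binom_total a p) mulr_suml [X in _ <= X + _]big_mkcond -big_split /=.
apply: ler_sum => k _; have ka : (k <= a)%N by rewrite -ltnS.
have Dk (A B : pred (digraph n)) : (forall G, #|G| = k -> A G -> B G) ->
    Pr (@Dnm R n k) A <= Pr (@Dnm R n k) B.
  move=> AB; rewrite /Pr [leLHS]big_mkcond [leRHS]big_mkcond; apply: ler_sum => G _.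
  have := Dnm_ge0 R k G; rewrite /Dnm; case: eqP => [Gk|_].
    by move=> D0; case: ifPn => [/(AB _ Gk) ->//|_]; case: ifP.
  by case: ifP; case: ifP.
case: ifPn => xk.
  apply: (@le_trans _ _ (binom_mass p a k * 1)); last by rewrite mulr1 lerDl mulr_ge0.
  by rewrite ler_wpM2l// -(Dnm_total R ka); apply: Dk.
rewrite add0r ler_wpM2l//; apply: le_trans (H k ka _); last by rewrite leNgt.
by apply: Dk => G ->; rewrite (negbTE xk).
Qed.

Lemma dnp_cdf_close K e z t del eps : S != finset.set0 ->
  0 < K -> 0 <= z -> 0 <= e -> 4 * (K * d) <= 1 -> 4 * h%:R <= T -> 0 < beta -> e <= 4^-1 ->
  (2 * e + (h%:R * (4 * K ^+ 2 * d ^+ 2 + 6 * (h%:R / T) ^+ 2) + h%:R * d ^+ 2 / 2)) / beta <= del ->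
  (forall k, (k <= a)%N -> `|bstd a p s k| <= K ->
     Pr (@Dnm R n k) (fun G => e < rel_dev k G) <= z) ->
  `|\sum_(k < a.+1 | bstd a p s k <= t - del) binom_mass p a k - normal_cdf (t - del)| <= eps ->
  `|\sum_(k < a.+1 | bstd a p s k <= t + del) binom_mass p a k - normal_cdf (t + del)| <= eps ->
  `|Pr (@Dnp R n p) (fun G => (lne (expR (beta ^+ 2 / 2) * (nbcopies S G)%:R
        / (#|S|%:R * p ^+ h))%:E * beta^-1%:E <= t%:E)%E) - normal_cdf t|
   <= (K ^+ 2)^-1 + z + eps + normal_peak 1 * del.
Proof.
move=> S0 K0 z0 e0 Kd hT b0 e4 small Hz cl cu.
have del0 : 0 <= del.
  apply: le_trans small; rewrite divr_ge0 ?(ltW b0)// !addr_ge0 ?divr_ge0//.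
  - by rewrite mulr_ge0.
  - apply: mulr_ge0 => //; apply: addr_ge0; last by rewrite mulr_ge0// sqr_ge0.
    by apply: mulr_ge0; [apply: mulr_ge0|]; rewrite ?sqr_ge0.
  - by rewrite mulr_ge0 ?sqr_ge0.
pose B := fun G : digraph n => (K < `|bstd a p s #|G| |) || (e < rel_dev #|G| G).
pose Y G := (lne (expR (beta ^+ 2 / 2) * (nbcopies S G)%:R
        / (#|S|%:R * p ^+ h))%:E * beta^-1%:E)%E.
have close G : ~~ B G -> exists2 r : R, Y G = r%:E & `|r - bstd a p s #|G| | <= del.
  rewrite negb_or -!leNgt => /andP[xK dev].
  have [r Yr rx] := log_count_close S0 xK Kd hT b0 e4 dev.
  by exists r => //; exact: le_trans small.
have := Pr_sandwich t (fun G => Dnp_ge0 p01 G) close.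
rewrite (Pr_Dnp_card n p (fun k => bstd a p s k <= t - del)).
rewrite (Pr_Dnp_card n p (fun k => bstd a p s k <= t + del)).
have bad : Pr (@Dnp R n p) B <= (K ^+ 2)^-1 + z by exact: Pr_bad.
have lip u : normal_cdf (u + del) - normal_cdf u <= normal_peak 1 * del :> R.
  rewrite [X in _ <= _ * X](_ : del = u + del - u); last by ring.
  by apply: normal_cdf_lipschitz; rewrite lerDl.
have lip1 := lip t; have lip2 := lip (t - del); rewrite subrK in lip2.
move: cl cu; rewrite !ler_norml => /andP[cl1 cl2] /andP[cu1 cu2] /andP[s1 s2].
rewrite /Y in s1 s2.
by apply/andP; split; lra.
Qed.

End LogCount.

(** * The log-normal limit for independent arcs *)

Lemma limn_einf_gt0 (R : realType) (u : nat -> R) :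
  (0 < limn_einf (fun n => (u n)%:E))%E ->
  exists2 c : R, 0 < c & \forall n \near \oo, c <= u n.
Proof.
rewrite limn_einf_lim (cvg_lim _ (@cvg_einfs_sup _ _))// => /ereal_sup_gt[_ [N _ <-]].
have lb n : (N <= n)%N -> (einfs (fun n => (u n)%:E) N <= (u n)%:E)%E.
  by move=> Nn; apply: ereal_inf_lbound; exists n.
case: (einfs _ N) lb => [r| |]// lb r0.
  by exists r => //; exists N => // n /= /lb; rewrite lee_fin.
by exists 1 => //; exists N => // n /= /lb; rewrite leye_eq.
Qed.

Lemma double_nbpairs (n : nat) : (2 * nbpairs n = n * n.-1)%N.
Proof. by rewrite mulnC /nbpairs (bin_ffact n 2) ffactnS ffactn1. Qed.

Lemma sqr_le_double_nbpairs (R : realType) (n : nat) : (2 <= n)%N ->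
  n%:R ^+ 2 <= 2 * (2 * nbpairs n)%:R :> R.
Proof.
by move=> n2; rewrite -natrX -natrM ler_nat double_nbpairs; nia.
Qed.

(** The convergence assumed along single sequences [m n] is uniform over each
    window around the mean: otherwise a sequence of bad choices of [m n] would
    contradict it. *)
Lemma rel_dev_uniform (R : realType) (S : forall n, {set digraph n}) (T : nat -> R)
    (K e z : R) :
  (forall m : nat -> nat, (forall n, (m n <= 2 * nbpairs n)%N) ->
    (fun n => (m n)%:R - T n : R) =O_\oo (fun n => Num.sqrt (T n) : R) ->
    cvg_in_prob (fun n => @Dnm R n (m n))
      (fun n G => (nbcopies (S n) G)%:R
         / Ex (@Dnm R n (m n)) (fun G' => (nbcopies (S n) G')%:R)) 1) ->
  (forall n, T n <= (2 * nbpairs n)%:R) -> (\forall n \near \oo, 1 <= T n) ->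
  0 < e -> 0 < z ->
  \forall n \near \oo, forall k, (k <= 2 * nbpairs n)%N ->
    `|k%:R - T n| <= K * Num.sqrt (T n) ->
    Pr (@Dnm R n k) (fun G => e < rel_dev R (S n) k G) <= z.
Proof.
move=> H Ta T1 e0 z0.
pose bad n (k : nat) := (`|k%:R - T n| <= K * Num.sqrt (T n)) &&
  (z < Pr (@Dnm R n k) (fun G => e < rel_dev R (S n) k G)).
pose m n := if [pick k : 'I_(2 * nbpairs n).+1 | bad n k] is Some k then k : nat
  else Num.truncn (T n).
have ma n : (m n <= 2 * nbpairs n)%N.
  rewrite /m; case: pickP => [k _|_]; first by rewrite -ltnS.
  rewrite truncn_le_nat; apply: le_lt_trans (Ta n) _; by rewrite ltr_nat.
have mO : (fun n => (m n)%:R - T n : R) =O_\oo (fun n => Num.sqrt (T n) : R).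
  apply/eqO_exP; exists (Num.max K 1); first by rewrite lt_max ltr01 orbT.
  move: T1; apply: filterS => n T1; rewrite (ger0_norm (sqrtr_ge0 _)).
  rewrite /m; case: pickP => [k /andP[le _]|_].
    by apply: (le_trans le); rewrite ler_wpM2r ?sqrtr_ge0// le_max lexx.
  apply: (@le_trans _ _ (1 * Num.sqrt (T n))); last first.
    by rewrite ler_wpM2r ?sqrtr_ge0// le_max lexx orbT.
  have s1 : 1 <= Num.sqrt (T n) by rewrite -[leLHS]sqrtr1 ler_wsqrtr.
  have T0 : 0 <= T n by apply: le_trans T1.
  have /andP[t1 t2] := truncn_itv T0; rewrite -natr1 in t2.
  by rewrite mul1r ler_norml; apply/andP; split; lra.
have /cvgrPdist_lt/(_ z z0) := H m ma mO e e0.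
apply: filterS => n; rewrite sub0r normrN.
rewrite ger0_norm; last by apply: Pr_ge0; exact: Dnm_ge0.
move=> good k ka kw; rewrite leNgt; apply/negP => zk.
have kb : bad n (inord k : 'I_(2 * nbpairs n).+1) by rewrite /bad inordK ?ltnS// kw.
move: good; rewrite /m; case: pickP => [l /andP[_ zl]|/(_ (inord k))]; last by rewrite kb.
by move=> /(lt_trans zl); rewrite ltxx.
Qed.

(** How [h ^ 3 = o (T ^ 2)] and [beta = h d >= c] are used. From the latter
    [T c ^ 2 <= h ^ 2], which turns the former into [h / T <= 1 / (M c ^ 2)]. *)
Lemma regime_bounds (R : realType) (h p T d c K s0 del M : R) :
  1 <= h -> 0 < p < 1 -> 0 < T -> 0 < d -> d ^+ 2 = (1 - p) / T ->
  0 < c -> c <= h * d -> 1 <= K -> 0 <= s0 -> 0 < del -> h ^+ 3 * M <= T ^+ 2 ->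
  256 * K ^+ 4 <= M -> 4 <= M * c ^+ 2 -> (s0 + 1) ^+ 2 <= M * c ^+ 2 ->
  ((4 * K ^+ 2 + 1) / c ^+ 2 + 6) * (2 / (del * c)) <= M ->
  [/\ 4 * (K * d) <= 1, 4 * h <= T, s0 + 1 <= T * d &
    h * (4 * K ^+ 2 * d ^+ 2 + 6 * (h / T) ^+ 2) + h * d ^+ 2 / 2 <= del * c / 2].
Proof.
move=> h1 /andP[p0 p1] T0 d0 dE c0 chd K1 s00 del0 hM MK M4 Ms Md.
have h0 : 0 < h by lra.
have K0 : 0 < K by lra.
have c20 : 0 < c ^+ 2 by rewrite exprn_gt0.
have d2T : d ^+ 2 <= T^-1.
  by rewrite dE ler_pdivrMr// mulVf ?gt_eqF//; lra.
have M0 : 0 < M.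
  by apply: lt_le_trans MK; apply: mulr_gt0; [rewrite ltr0n|exact: exprn_gt0].
have h31 : 1 <= h ^+ 3 by rewrite exprn_ege1.
have MT : M <= T ^+ 2 by apply: le_trans hM; rewrite ler_peMl// ltW.
have T16 : 16 * K ^+ 2 <= T.
  rewrite -ler_sqr ?nnegrE ?(ltW T0)//; last by rewrite mulr_ge0 ?sqr_ge0.
  apply: (le_trans _ MT); apply: le_trans MK.
  by rewrite le_eqVlt; apply/orP; left; apply/eqP; ring.
have cT : T * c ^+ 2 <= h ^+ 2.
  have c2 : c ^+ 2 <= h ^+ 2 * T^-1.
    apply: (@le_trans _ _ ((h * d) ^+ 2)).
      by rewrite ler_sqr ?nnegrE ?(ltW c0)// (le_trans (ltW c0)).
    by rewrite exprMn ler_wpM2l// sqr_ge0.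
  by move: c2; rewrite ler_pdivlMr// mulrC.
have hcT : h * (M * c ^+ 2) <= T.
  rewrite -(ler_pM2l T0) -expr2; apply: le_trans hM.
  rewrite [leLHS](_ : _ = h * M * (T * c ^+ 2)); last by ring.
  rewrite [leRHS](_ : _ = h * M * h ^+ 2); last by ring.
  by rewrite ler_wpM2l// mulr_ge0 ?ltW.
have hT : h / T <= (M * c ^+ 2)^-1.
  by rewrite ler_pdivrMr// ler_pdivlMl ?mulr_gt0// mulrC.
split.
- rewrite -[leRHS]ger0_norm// -[leLHS]ger0_norm; last by rewrite !mulr_ge0 ?ltW.
  rewrite -ler_sqr ?nnegrE// !real_normK ?num_real// expr1n.
  rewrite [leLHS](_ : _ = 16 * K ^+ 2 * d ^+ 2); last by ring.
  apply: (@le_trans _ _ (T * T^-1)); last by rewrite mulfV ?gt_eqF.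
  by apply: ler_pM => //; [rewrite mulr_ge0 ?sqr_ge0|exact: sqr_ge0].
- by apply: le_trans hcT; rewrite mulrC ler_wpM2l// ltW.
- rewrite -ler_sqr ?nnegrE ?mulr_ge0 ?(ltW T0) ?(ltW d0)//; last lra.
  apply: (le_trans Ms); rewrite -(ler_pM2l (exprn_gt0 2 h0)).
  apply: (@le_trans _ _ (T ^+ 2 * c ^+ 2)).
    apply: (@le_trans _ _ (h ^+ 3 * M * c ^+ 2)); last by rewrite ler_wpM2r ?(ltW c20).
    rewrite [leRHS](_ : _ = h * (h ^+ 2 * (M * c ^+ 2))); last by ring.
    by rewrite ler_peMl// mulr_ge0 ?sqr_ge0// mulr_ge0 ?ltW.
  rewrite [leRHS](_ : _ = T ^+ 2 * (h * d) ^+ 2); last by ring.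
  by rewrite ler_wpM2l ?sqr_ge0// ler_sqr ?nnegrE ?(ltW c0)// (le_trans (ltW c0)).
have hd : h * d ^+ 2 <= (M * c ^+ 2)^-1.
  by apply: le_trans hT; rewrite ler_wpM2l// ltW.
have hhT : h * (h / T) ^+ 2 <= M^-1.
  rewrite [leLHS](_ : _ = h ^+ 3 / T ^+ 2); last by field; rewrite gt_eqF.
  by rewrite ler_pdivrMr ?exprn_gt0// ler_pdivlMl// mulrC.
apply: (@le_trans _ _ (((4 * K ^+ 2 + 1) / c ^+ 2 + 6) / M)).
  have K2 : 0 <= 4 * K ^+ 2 by rewrite mulr_ge0 ?sqr_ge0.
  have H1 := ler_wpM2l K2 hd.
  have H0 : 0 <= h * d ^+ 2 by rewrite mulr_ge0 ?sqr_ge0// ltW.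
  rewrite [leRHS](_ : _ = 4 * K ^+ 2 * (M * c ^+ 2)^-1 + (M * c ^+ 2)^-1 + 6 * M^-1); last first.
    by field; rewrite !gt_eqF.
  rewrite mulrDr [h * (4 * _ * _)](_ : _ = 4 * K ^+ 2 * (h * d ^+ 2)); last by ring.
  rewrite [h * (6 * _)](_ : _ = 6 * (h * (h / T) ^+ 2)); last by ring.
  clear -H0 H1 hhT hd; lra.
rewrite ler_pdivrMr// -ler_pdivrMl; last by rewrite divr_gt0 ?mulr_gt0.
by rewrite invf_div mulrC.
Qed.

Section NormalLimit.
Variables (R : realType) (h : nat -> nat) (S : forall n : nat, {set digraph n}).
Hypothesis hS : forall (n : nat) (H : digraph n), H \in S n -> #|H| = h n.
Variable p : nat -> R.
Hypothesis p01 : forall n, 0 < p n < 1.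

Definition mean_arcs n : R := 2 * p n * (nbpairs n)%:R.
Local Notation T := mean_arcs.

Let d n : R := Num.sqrt ((1 - p n) / T n).

Lemma mean_arcsE n : T n = (2 * nbpairs n)%:R * p n.
Proof. by rewrite /mean_arcs natrM; ring. Qed.

Lemma mean_arcs_le n : T n <= (2 * nbpairs n)%:R.
Proof. by rewrite mean_arcsE ler_piMr//; case/andP: (p01 n) => _ /ltW. Qed.

Lemma Dnp_regime (c M : R) : 0 < c -> 0 < M ->
  (fun n => (h n)%:R ^+ 3 : R) =o_\oo (fun n => p n ^+ 2 * n%:R ^+ 4 : R) ->
  (\forall n \near \oo, c <= (h n)%:R * d n) ->
  \forall n \near \oo, [/\ (0 < h n)%N, 0 < T n, c <= (h n)%:R * d n &
    (h n)%:R ^+ 3 * M <= T n ^+ 2].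
Proof.
move=> c0 M0 h3 cd; have M4i : 0 < (4 * M)^-1 by rewrite invr_gt0 mulr_gt0.
have /eqoP/(_ _ M4i) := h3 => {}h3.
near=> n.
have n2 : (2 <= n)%N by near: n; exists 2.
have [p0 _] := andP (p01 n).
have nb : (0 < 2 * nbpairs n)%N by rewrite double_nbpairs muln_gt0; clear -n2; lia.
have T0 : 0 < T n by rewrite mean_arcsE mulr_gt0// ltr0n.
have cb : c <= (h n)%:R * d n by near: n.
have h0 : (0 < h n)%N.
  rewrite lt0n; apply/negP => /eqP E; move: cb; rewrite E mul0r.
  by rewrite leNgt c0.
split => //.
have : `|(h n)%:R ^+ 3 : R| <= (4 * M)^-1 * `|p n ^+ 2 * n%:R ^+ 4| by near: n.
have p20 : 0 <= p n ^+ 2 by exact: sqr_ge0.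
rewrite ger0_norm ?exprn_ge0// ger0_norm; last by rewrite mulr_ge0// exprn_ge0.
move=> le.
have pT : p n * n%:R ^+ 2 <= 2 * T n.
  rewrite mean_arcsE [leRHS](_ : _ = p n * (2 * (2 * nbpairs n)%:R)); last by ring.
  by apply: ler_wpM2l; [exact: ltW|exact: sqr_le_double_nbpairs].
have pT2 : p n ^+ 2 * n%:R ^+ 4 <= 4 * T n ^+ 2.
  rewrite [leLHS](_ : _ = (p n * n%:R ^+ 2) ^+ 2); last by ring.
  rewrite [leRHS](_ : _ = (2 * T n) ^+ 2); last by ring.
  have pn0 : 0 <= p n * n%:R ^+ 2 by rewrite mulr_ge0 ?exprn_ge0// ltW.
  by rewrite ler_sqr// nnegrE// (le_trans pn0).
rewrite -ler_pdivlMr//; apply: (le_trans le).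
rewrite ler_pdivrMl ?mulr_gt0//; apply: (le_trans pT2).
by rewrite le_eqVlt; apply/orP; left; apply/eqP; field; rewrite gt_eqF.
Unshelve. all: by end_near.
Qed.

(** For empty [S] the quotient would be [0 / 0 = 0], at distance [1] from [1]; the
    window is not empty, as it contains the integer part of [T]. *)
Lemma nonempty_of_rel_dev n K e z : 1 <= K -> 1 <= T n * d n -> 0 < T n ->
  e < 1 -> z < 1 ->
  (forall k, (k <= 2 * nbpairs n)%N ->
    `|bstd (2 * nbpairs n) (p n) (T n * d n) k| <= K ->
    Pr (@Dnm R n k) (fun G => e < rel_dev R (S n) k G) <= z) ->
  S n != finset.set0.
Proof.
move=> K1 Td1 T0 e1 z1 win; apply/negP => /eqP S0.
pose k := Num.truncn (T n).
have /andP[t1 t2] : k%:R <= T n < k.+1%:R by rewrite truncn_itv// ltW.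
rewrite -natr1 in t2.
have ka : (k <= 2 * nbpairs n)%N.
  by rewrite truncn_le_nat; apply: le_lt_trans (mean_arcs_le n) _; rewrite ltr_nat.
have Td0 : 0 < T n * d n by exact: lt_le_trans Td1.
have kw : `|bstd (2 * nbpairs n) (p n) (T n * d n) k| <= K.
  rewrite /bstd -mean_arcsE normrM normfV (gtr0_norm Td0) ler_pdivrMr//.
  apply: (@le_trans _ _ (1 * 1)); last by apply: ler_pM.
  by rewrite ler_norml; apply/andP; split; lra.
have := win k ka kw; apply/negP; rewrite -ltNge; apply: (lt_le_trans z1).
rewrite -(Dnm_total R ka); apply: le_Pr; first exact: Dnm_ge0.
move=> G _; rewrite /rel_dev S0.
have -> : nbcopies (finset.set0 : {set digraph n}) G = 0%N.
  by apply: eq_card0 => H; rewrite !inE.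
by rewrite mul0r sub0r normrN1.
Qed.

Definition log_count n (G : digraph n) : \bar R := (lne (expR (((h n)%:R * d n) ^+ 2 / 2) * (nbcopies (S n) G)%:R
   / (#|S n|%:R * p n ^+ h n))%:E * ((h n)%:R * d n)^-1%:E)%E.

Lemma dnp_cdf_regime n (t c K e z del eps s0 M : R) :
  (0 < h n)%N -> 0 < T n -> 0 < c -> c <= (h n)%:R * d n ->
  (h n)%:R ^+ 3 * M <= T n ^+ 2 ->
  1 <= K -> 0 <= s0 -> 0 < del -> 0 <= z -> z < 1 -> 0 < e -> e <= 4^-1 -> e <= del * c / 4 ->
  256 * K ^+ 4 <= M -> 4 <= M * c ^+ 2 -> (s0 + 1) ^+ 2 <= M * c ^+ 2 ->
  ((4 * K ^+ 2 + 1) / c ^+ 2 + 6) * (2 / (del * c)) <= M ->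
  (forall k, (k <= 2 * nbpairs n)%N -> `|k%:R - T n| <= K * Num.sqrt (T n) ->
    Pr (@Dnm R n k) (fun G => e < rel_dev R (S n) k G) <= z) ->
  (forall s, s0 <= s -> s ^+ 2 = (2 * nbpairs n)%:R * p n * (1 - p n) ->
     `|\sum_(k < (2 * nbpairs n).+1 | bstd (2 * nbpairs n) (p n) s k <= t - del)
        binom_mass (p n) (2 * nbpairs n) k - normal_cdf (t - del)| <= eps /\
     `|\sum_(k < (2 * nbpairs n).+1 | bstd (2 * nbpairs n) (p n) s k <= t + del)
        binom_mass (p n) (2 * nbpairs n) k - normal_cdf (t + del)| <= eps) ->
  `|Pr (@Dnp R n (p n)) (fun G => (log_count G <= t%:E)%E) - normal_cdf t|
    <= (K ^+ 2)^-1 + z + eps + normal_peak 1 * del.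
Proof.
move=> h0 T0 c0 cb hM K1 s00 del0 z0 z1 e0 e4 edel M1 M2 M3 M4 un clt.
have [p0 p1] := andP (p01 n).
have dq : 0 < (1 - p n) / T n by rewrite divr_gt0// subr_gt0.
have d0 : 0 < d n by rewrite sqrtr_gt0.
have dE : d n ^+ 2 = (1 - p n) / T n by rewrite sqr_sqrtr// ltW.
have hR1 : 1 <= (h n)%:R :> R by rewrite ler1n.
have [Kd hT sT om] := regime_bounds hR1 (p01 n) T0 d0 dE c0 cb K1 s00 del0 hM
  M1 M2 M3 M4.
have b0 : 0 < (h n)%:R * d n by exact: lt_le_trans cb.
have Td0 : 0 < T n * d n by rewrite mulr_gt0.
have TdE : (T n * d n) ^+ 2 = (2 * nbpairs n)%:R * p n * (1 - p n).
  by rewrite exprMn dE -mean_arcsE; field; rewrite gt_eqF.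
have Tds : T n * d n <= Num.sqrt (T n).
  rewrite -(@ler_sqr R) ?nnegrE ?(ltW Td0) ?sqrtr_ge0//.
  rewrite TdE -mean_arcsE sqr_sqrtr ?(ltW T0)//.
  by rewrite ler_piMr ?(ltW T0)// gerBl ltW.
have win k : (k <= 2 * nbpairs n)%N ->
    `|bstd (2 * nbpairs n) (p n) (T n * d n) k| <= K ->
    Pr (@Dnm R n k) (fun G => e < rel_dev R (S n) k G) <= z.
  move=> ka xk; apply: un => //; move: xk.
  rewrite /bstd -mean_arcsE normrM normfV (gtr0_norm Td0) ler_pdivrMr// => xk.
  by apply: (le_trans xk); rewrite ler_wpM2l// (le_trans ler01).
have s0T : s0 <= T n * d n by apply: le_trans sT; rewrite lerDl.
have sT1 : 1 <= T n * d n by apply: le_trans sT; rewrite lerDr.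
have e1 : e < 1 by apply: (le_lt_trans e4); rewrite invf_lt1// ltr1n.
have Sn0 := nonempty_of_rel_dev K1 sT1 T0 e1 z1 win.
have small : (2 * e + ((h n)%:R * (4 * K ^+ 2 * d n ^+ 2 + 6 * ((h n)%:R / T n) ^+ 2)
   + (h n)%:R * d n ^+ 2 / 2)) / ((h n)%:R * d n) <= del.
  rewrite ler_pdivrMr//; apply: (@le_trans _ _ (del * c)).
    by move: om edel; set A := _ + _ / 2; lra.
  by rewrite ler_wpM2l// ltW.
have [c1 c2] := clt _ s0T TdE.
have K0 : 0 < K by exact: lt_le_trans K1.
rewrite mean_arcsE in dE T0 hT small win c1 c2.
exact: (dnp_cdf_close (@hS n) (p01 n) d0 dE T0 Sn0 K0 z0 (ltW e0) Kd hT b0 e4 small win c1 c2).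
Qed.

End NormalLimit.

(** The log-normal limit. All constants are fixed before [n]: [K] bounds the
    window for the standardised number of arcs, [e] and [del] the accepted errors
    inside it, and [M] collects what the growth condition has to ensure. *)
Theorem log_nbcopies_Dnp_normal (R : realType) (h : nat -> nat)
    (S : forall n : nat, {set digraph n})
    (hS : forall (n : nat) (H : digraph n), H \in S n -> #|H| = h n)
    (p : nat -> R) :
    let beta : nat -> R := fun n =>
      (h n)%:R * Num.sqrt ((1 - p n) / (2 * p n * (nbpairs n)%:R)) in
    let lambda : nat -> R := fun n => #|S n|%:R * p n ^+ h n in
    (forall n : nat, 0 < p n < 1) ->
    (fun n => (h n)%:R ^+ 3 : R) =o_\oo (fun n => p n ^+ 2 * n%:R ^+ 4 : R) ->
    (0 < limn_einf (fun n => (beta n)%:E))%E ->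
    (forall m : nat -> nat,
      (forall n : nat, (m n <= 2 * nbpairs n)%N) ->
      (fun n => (m n)%:R - 2 * p n * (nbpairs n)%:R : R)
        =O_\oo (fun n => Num.sqrt (2 * p n * (nbpairs n)%:R) : R) ->
      cvg_in_prob (fun n => @Dnm R n (m n))
        (fun n G => (nbcopies (S n) G)%:R
           / Ex (@Dnm R n (m n)) (fun G' => (nbcopies (S n) G')%:R)) 1) ->
    cvg_in_distr (fun n => @Dnp R n (p n))
      (fun n G =>
         (lne (expR (beta n ^+ 2 / 2) * (nbcopies (S n) G)%:R / lambda n)%:E
            * (beta n)^-1%:E)%E)
      (normal_prob 0 1).
Proof.
move=> beta lambda p01 h3 /limn_einf_gt0[c c0 cbeta] Hm t _.
rewrite (normal_cdfE t).
suff key : Pr (@Dnp R n (p n)) (fun G => (log_count h S p G <= t%:E)%E) @[n --> \oo]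
    --> normal_cdf t by apply/fine_cvgP; split; [exact: nearW|exact: key].
apply/cvgrPdist_le => eps eps0.
have q0 : 0 < 4 / eps by rewrite divr_gt0.
have [K K1 Keps] : exists2 K : R, 1 <= K & (K ^+ 2)^-1 <= eps / 4.
  exists (1 + 4 / eps); first by rewrite lerDl ltW.
  have K0 : 0 < 1 + 4 / eps by rewrite ltr_wpDl.
  rewrite -[leRHS]invrK lef_pV2 ?posrE ?exprn_gt0 ?invr_gt0 ?divr_gt0// invf_div.
  apply: (@le_trans _ _ (1 + 4 / eps)); first by rewrite lerDr.
  by rewrite expr2 ler_peMr ?(ltW K0)// lerDl ltW.
have eps40 : 0 < eps / 4 by rewrite divr_gt0.
have [z [z0 z1 zeps]] : exists z : R, [/\ 0 < z, z < 1 & z <= eps / 4].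
  exists (Num.min (eps / 4) (1 / 2)); split; last by rewrite ge_min lexx.
    by rewrite lt_min eps40 divr_gt0.
  by rewrite gt_min; apply/orP; right; lra.
have pk0 : 0 <= normal_peak 1 :> R by exact: normal_peak_ge0.
have [del del0 delp] : exists2 del : R, 0 < del & normal_peak 1 * del <= eps / 4.
  have pk1 : 0 < normal_peak 1 + 1 :> R by rewrite ltr_wpDl.
  exists (eps / 4 / (normal_peak 1 + 1)); first by rewrite !divr_gt0.
  rewrite mulrCA ler_piMr ?(ltW eps40)// ler_pdivrMr// mul1r lerDl//.
have dc0 : 0 < del * c / 4 by rewrite divr_gt0 ?mulr_gt0.
have [e [e0 e4 edel]] : exists e : R, [/\ 0 < e, e <= 4^-1 & e <= del * c / 4].
  exists (Num.min 4^-1 (del * c / 4)).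
  by rewrite lt_min dc0 !ge_min !lexx orbT andbT invr_gt0.
have [s1 s10 clt1] := de_moivre_laplace (t - del) eps40.
have [s2 s20 clt2] := de_moivre_laplace (t + del) eps40.
have [s0 [s00 s01 s02]] : exists s0 : R, [/\ 0 <= s0, s1 <= s0 & s2 <= s0].
  by exists (s1 + s2); rewrite addr_ge0 ?lerDl ?lerDr ?ltW.
have c20 : 0 < c ^+ 2 by rewrite exprn_gt0.
have [M [M1 M2 M3 M4]] : exists M : R, [/\ 256 * K ^+ 4 <= M, 4 <= M * c ^+ 2,
    (s0 + 1) ^+ 2 <= M * c ^+ 2 &
    ((4 * K ^+ 2 + 1) / c ^+ 2 + 6) * (2 / (del * c)) <= M].
  exists (Num.max (Num.max (256 * K ^+ 4) (4 / c ^+ 2)) (Num.max ((s0 + 1) ^+ 2 / c ^+ 2)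
     (((4 * K ^+ 2 + 1) / c ^+ 2 + 6) * (2 / (del * c))))).
  by rewrite -!(ler_pdivrMr _ _ c20) !le_max !lexx !orbT.
have K41 : 1 <= K ^+ 4 by rewrite exprn_ege1.
have M1_1 : 1 <= M by apply: le_trans M1; clear -K41; lra.
have M0 : 0 < M by exact: lt_le_trans M1_1.
have regime := Dnp_regime p01 c0 M0 h3 cbeta.
have T1 : \forall n \near \oo, 1 <= mean_arcs p n.
  move: regime; apply: filterS => n [h0 T0 _ hM].
  rewrite -(@ler_sqr R) ?nnegrE ?(ltW T0)// expr1n; apply: le_trans hM.
  by rewrite mulr_ege1// exprn_ege1// ler1n.
have unif := @rel_dev_uniform R S (mean_arcs p) K e z Hm (mean_arcs_le p01) T1 e0 z0.
near=> n.
have [h0 T0 cb hM] : [/\ (0 < h n)%N, 0 < mean_arcs p n,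
    c <= (h n)%:R * Num.sqrt ((1 - p n) / mean_arcs p n) &
    (h n)%:R ^+ 3 * M <= mean_arcs p n ^+ 2] by near: n.
have un : forall k, (k <= 2 * nbpairs n)%N ->
    `|k%:R - mean_arcs p n| <= K * Num.sqrt (mean_arcs p n) ->
    Pr (@Dnm R n k) (fun G => e < rel_dev R (S n) k G) <= z by near: n.
rewrite distrC.
apply: (@le_trans _ _ ((K ^+ 2)^-1 + z + eps / 4 + normal_peak 1 * del)); last first.
  by clear -Keps zeps delp; lra.
apply: (dnp_cdf_regime hS p01 h0 T0 c0 cb hM K1 s00 del0 (ltW z0) z1 e0 e4 edel M1 M2 M3 M4 un).
move=> s s0s sE; split.
  by apply: clt1 => //; exact: le_trans s0s.
by apply: clt2 => //; exact: le_trans s0s.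
Unshelve. all: by end_near.
Qed.

Theorem theorem5 (R : realType) (h : nat -> nat)
    (S : forall n : nat, {set digraph n})
    (hS : forall (n : nat) (H : digraph n), H \in S n -> #|H| = h n) :
  (forall (m : nat -> nat) (gamma : nat -> R),
    let rho : nat -> R := fun n => (h n)%:R ^+ 2 / (m n)%:R in
    let mu : nat -> R := fun n => mean_formula R (S n) (h n) (m n) in
    (forall n : nat, (m n <= 2 * nbpairs n)%N) ->
    (\forall n \near \oo, (0 < m n)%N) ->
    (fun n => (h n)%:R ^+ 3 : R) =o_\oo (fun n => (m n)%:R ^+ 2 : R) ->
    (fun n => (h n)%:R ^+ 2 : R) =Omega_\oo (fun n => (m n)%:R : R) ->
    (* (a) *)
    (forall K : R, 0 < K ->
      exists (e : nat -> R) (delta : nat -> nat -> R),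
        e =o_\oo (fun n => (m n)%:R / (h n)%:R ^+ 2 : R) /\
        \forall n \near \oo, forall j : nat,
          (1 <= j)%N -> j%:R <= K * rho n ->
          [/\ `|delta n j| <= e n,
              nbshare (S n) j.-1 <> 0%N &
              share_ratio R (S n) j =
                (h n)%:R ^+ 2 / (2 * (nbpairs n)%:R * j%:R)
                  * (1 + delta n j)]) ->
    (* (b) *)
    (\forall n \near \oo, forall j : nat,
      (1 <= j)%N -> 4 * rho n <= j%:R -> j%:R <= gamma n ->
      (nbshare (S n) j.-1 <> 0%N ->
         share_ratio R (S n) j <= (m n)%:R / (4 * (nbpairs n)%:R)) /\
      (nbshare (S n) j.-1 = 0%N -> nbshare (S n) j = 0%N)) ->
    (* (c) *)
    (fun n => \sum_(0 <= j < (h n).+1 | gamma n < j%:R)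
                (nbshare (S n) j)%:R : R)
      =o_\oo (fun n => mu n * #|S n|%:R : R) ->
    cvg_in_prob (fun n => @Dnm R n (m n))
      (fun n G => (nbcopies (S n) G)%:R
         / Ex (@Dnm R n (m n)) (fun G' => (nbcopies (S n) G')%:R)) 1)
  /\
  (forall (p : nat -> R),
    let beta : nat -> R := fun n =>
      (h n)%:R * Num.sqrt ((1 - p n) / (2 * p n * (nbpairs n)%:R)) in
    let lambda : nat -> R := fun n => #|S n|%:R * p n ^+ h n in
    (forall n : nat, 0 < p n < 1) ->
    (fun n => (h n)%:R ^+ 3 : R) =o_\oo (fun n => p n ^+ 2 * n%:R ^+ 4 : R) ->
    (0 < limn_einf (fun n => (beta n)%:E))%E ->
    (forall m : nat -> nat,
      (forall n : nat, (m n <= 2 * nbpairs n)%N) ->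
      (fun n => (m n)%:R - 2 * p n * (nbpairs n)%:R : R)
        =O_\oo (fun n => Num.sqrt (2 * p n * (nbpairs n)%:R) : R) ->
      cvg_in_prob (fun n => @Dnm R n (m n))
        (fun n G => (nbcopies (S n) G)%:R
           / Ex (@Dnm R n (m n)) (fun G' => (nbcopies (S n) G')%:R)) 1) ->
    cvg_in_distr (fun n => @Dnp R n (p n))
      (fun n G =>
         (lne (expR (beta n ^+ 2 / 2) * (nbcopies (S n) G)%:R / lambda n)%:E
            * (beta n)^-1%:E)%E)
      (normal_prob 0 1)).
Proof.
split; first by move=> m gamma; exact: nbcopies_Dnm_concentration.
by move=> p; exact: log_nbcopies_Dnp_normal.
Qed.
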